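(* Let $n \ge 3$ and let $M$ be a non-empty smooth $n$-dimensional manifold. Consider pseudo-Riemannian metrics $g_{\mu\nu}$ (of an arbitrary fixed signature $(p,q)$, $p+q=n$) on open subsets of $M$, with the inverse metric $g^{\mu\nu}$ regarded as the field variable. Then the densitised trace-free Einstein tensor $$\tilde{G}^{\mathrm{tf}}_{\mu\nu} := \sqrt{|\det(g_{\kappa\lambda})|}\,\left(R_{\mu\nu} - \frac{1}{n} R\, g_{\mu\nu}\right)$$ cannot arise by variation of any local action functional with respect to the inverse metric. That is, there exists no local action functional $S[g^{\mu\nu}] = \int \mathcal{L}[g^{\mu\nu}]\,\mathrm{d}^n x$, of any finite order and not assumed to be diffeomorphism invariant, whose variational derivative satisfies $$\frac{\delta S}{\delta g^{\mu\nu}} = \tilde{G}^{\mathrm{tf}}_{\mu\nu}$$ identically for all such metrics.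
   Context: $R_{\mu\nu}$ denotes the Ricci tensor of the Levi-Civita connection of $g_{\mu\nu}$ and $R = g^{\mu\nu}R_{\mu\nu}$ the Ricci scalar; $g^{\mu\nu}$ is the inverse of $g_{\mu\nu}$. Repeated indices are summed over. A local action functional is an integral $S[g^{\mu\nu}] = \int \mathcal{L}[g^{\mu\nu}]\,\mathrm{d}^n x$ over a (smooth) Lagrangian density $\mathcal{L}$ which depends pointwise on the field variable $g^{\mu\nu}$ and finitely many of its derivatives; i.e. for some finite $k$, in local coordinates, $\mathcal{L}$ at a point $x$ is a smooth function of $x$ and of the values at $x$ of $g^{\mu\nu}$ and its partial derivatives up to order $k$. No diffeomorphism invariance (general covariance) of $\mathcal{L}$ is assumed; in particular it may depend on fixed background structures. The variational derivative (Euler–Lagrange expression) $\frac{\delta S}{\delta g^{\mu\nu}}$ is the symmetric expression $E_{\mu\nu}[g^{\rho\sigma}]$, depending pointwise on $g^{\rho\sigma}$ and finitely many of its derivatives, uniquely determined by the requirement that for every smooth symmetric compactly supported variation $\delta g^{\mu\nu}$ (supported in the domain of the metric), $$\frac{\mathrm{d}}{\mathrm{d}\varepsilon}\Big|_{\varepsilon=0} \int \mathcal{L}[g^{\mu\nu} + \varepsilon\,\delta g^{\mu\nu}]\,\mathrm{d}^n x = \int E_{\mu\nu}[g^{\rho\sigma}]\,\delta g^{\mu\nu}\,\mathrm{d}^n x,$$ where the integrals are taken over the support of $\delta g^{\mu\nu}$. *)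

(* Defs.v *)
From mathcomp Require Import all_boot all_order all_algebra.
From mathcomp Require Import all_classical all_reals all_analysis.

Set Implicit Arguments.
Unset Strict Implicit.
Unset Printing Implicit Defensive.

Import Order.TTheory GRing.Theory Num.Theory.
Import numFieldNormedType.Exports.

Local Open Scope classical_set_scope.
Local Open Scope ring_scope.

Section Calculus.
Context {R : realType}.

Fixpoint Ck_on {V W : normedModType R} (k : nat) (U : set V) (f : V -> W) : Prop :=
  match k with
  | 0 => forall x, U x -> {for x, continuous f}
  | k'.+1 => (forall x, U x -> differentiable f x) /\
             (forall v, Ck_on k' U ('D_v f))
  end.

(* Only used for open [U]; see [smooth_on_subset] for other sets. *)
Definition smooth_on {V W : normedModType R} (U : set V) (f : V -> W) : Prop :=
  forall k, Ck_on k U f.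

(* Smoothness on an arbitrary subset: locally the restriction of a smooth
   function on an open set. On an embedded submanifold this is the intrinsic
   notion. *)
Definition smooth_on_subset {V W : normedModType R} (A : set V) (f : V -> W) : Prop :=
  forall a, A a -> exists (U : set V) (F : V -> W),
    [/\ open U, U a, smooth_on U F & forall x, U x -> A x -> F x = f x].

(* Lebesgue integral over R^n, written as an iterated integral: by Fubini the
   two agree on every Lebesgue-integrable Borel function. *)
Fixpoint integral_rV (n : nat) : ('rV[R]_n -> R) -> R :=
  match n return ('rV[R]_n -> R) -> R with
  | 0 => fun f => f 0
  | n'.+1 => fun f =>
      \int[lebesgue_measure]_x
         integral_rV (fun v : 'rV[R]_n' => f (row_mx (x%:M : 'rV[R]_1) v))
  end.

Definition partial {n : nat} {W : normedModType R} (i : 'I_n) (f : 'rV[R]_n -> W) :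
  'rV[R]_n -> W := 'D_(delta_mx 0 i) f.

Definition multi_index (n k : nat) : Type :=
  {a : {ffun 'I_n -> 'I_k.+1} | (\sum_i a i <= k)%N}.

Definition iter_partial {n k : nat} {W : normedModType R} (a : multi_index n k)
    (f : 'rV[R]_n -> W) : 'rV[R]_n -> W :=
  foldr (fun i => iter (sval a i) (partial i)) f (enum 'I_n).

(* A k-jet of a matrix-valued function: row [enum_rank a] holds the flattened
   matrix of the a-th partial derivatives. *)
Definition jet_type (n k : nat) : normedModType R :=
  'M[R]_(#|{: multi_index n k}|, n * n).

Definition jet (n k : nat) (h : 'rV[R]_n -> 'M[R]_n) (y : 'rV[R]_n) : jet_type n k :=
  \matrix_(r < #|{: multi_index n k}|) mxvec (iter_partial (enum_val r) h y).

End Calculus.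

Arguments jet_type R n k : clear implicits.

Section Curvature.
Context {R : realType} {n : nat}.
Implicit Types (h g : 'rV[R]_n -> 'M[R]_n) (y : 'rV[R]_n) (a b c d : 'I_n).

(* [h] holds the components of the inverse metric in a chart. *)
Definition metric_of h : 'rV[R]_n -> 'M[R]_n := fun y => invmx (h y).

Definition christoffel h a b c : 'rV[R]_n -> R := fun y =>
  2^-1 * \sum_d h y a d *
    (partial b (fun z => metric_of h z d c) y
     + partial c (fun z => metric_of h z b d) y
     - partial d (fun z => metric_of h z b c) y).

(* R^a_{bcd}, with the convention
   R(X, Y) Z = nabla_X nabla_Y Z - nabla_Y nabla_X Z - nabla_[X, Y] Z,
   so that the Ricci tensor of a round sphere is positive. *)
Definition riemann h a b c d y : R :=
  partial c (christoffel h a d b) y - partial d (christoffel h a c b) y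
  + \sum_e (christoffel h a c e y * christoffel h e d b y)
  - \sum_e (christoffel h a d e y * christoffel h e c b y).

Definition ricci h y : 'M[R]_n := \matrix_(b, d) \sum_a riemann h a b a d y.

Definition ricci_scalar h y : R := \sum_a \sum_b h y a b * ricci h y a b.

Definition tf_einstein_density h y : 'M[R]_n :=
  Num.sqrt `|\det (metric_of h y)| *:
    (ricci h y - (n%:R^-1 * ricci_scalar h y) *: metric_of h y).

Definition has_signature (p q : nat) (A : 'M[R]_n) : Prop :=
  [/\ (p + q)%N = n, A^T = A &
      exists2 P : 'M[R]_n, P \in unitmx &
        P^T *m A *m P = diag_mx (\row_(i < n) (if (i < p)%N then 1 else -1))].

End Curvature.

(* A smooth manifold, given by a (not necessarily maximal) smooth atlas. Values
   of [chart c] outside [dom c], and of [chart_inv c] outside the range of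
   [chart c], are irrelevant. *)
Record smooth_manifold (R : realType) (n : nat) := SmoothManifold {
  carrier :> topologicalType ;
  carrier_hausdorff : hausdorff_space carrier ;
  carrier_second_countable : @second_countable carrier ;
  atlas : Type ;
  dom : atlas -> set carrier ;
  chart : atlas -> carrier -> 'rV[R]_n ;
  chart_inv : atlas -> 'rV[R]_n -> carrier ;
  dom_cover : forall x, exists c, dom c x ;
  dom_open : forall c, open (dom c) ;
  chart_open : forall c, open (chart c @` dom c) ;
  chartK : forall c x, dom c x -> chart_inv c (chart c x) = x ;
  chart_continuous : forall c x, dom c x -> {for x, continuous (chart c)} ;
  chart_inv_continuous : forall c y, (chart c @` dom c) y ->
    {for y, continuous (chart_inv c)} ;
  transition_smooth : forall c c',
    smooth_on (chart c @` (dom c `&` dom c')) (chart c' \o chart_inv c)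
}.

Section Fields.
Context {R : realType} {n : nat} (M : smooth_manifold R n).
Implicit Types (c : atlas M) (U K : set M).

(* (jacobian_at c c' x) a b is the derivative of the a-th coordinate of c'
   along the b-th coordinate of c; ['J] acts on row vectors, hence the
   transposition. *)
Definition jacobian_at c c' (x : M) : 'M[R]_n :=
  ('J (chart c' \o chart_inv c) (chart c x))^T.

(* The components, in every chart and as functions of the coordinates, of a
   two-index object on an open subset U of M. Only the values of [h c] on
   chart c @` (U `&` dom c) are meaningful. *)
Definition field : Type := atlas M -> 'rV[R]_n -> 'M[R]_n.

Definition sym_contra_tensor (U : set M) (h : field) : Prop :=
  [/\ forall c, smooth_on (chart c @` (U `&` dom c)) (h c),
      forall c x, U x -> dom c x -> (h c (chart c x))^T = h c (chart c x) &
      forall c c' x, U x -> dom c x -> dom c' x ->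
        h c' (chart c' x) =
        jacobian_at c c' x *m h c (chart c x) *m (jacobian_at c c' x)^T].

Definition inverse_metric (p q : nat) (U : set M) (h : field) : Prop :=
  sym_contra_tensor U h /\
  forall c x, U x -> dom c x -> has_signature p q (metric_of (h c) (chart c x)).

Definition tensor_support (U : set M) (h : field) : set M :=
  closure [set x | U x /\ exists2 c, dom c x & h c (chart c x) != 0].

(* Integral over K of the density with coordinate expressions w, for K inside
   the union of the domains of the charts cs: K is cut into the disjoint pieces
   K `&` dom c minus the domains of the charts preceding c in cs. When w
   transforms as a density the value does not depend on cs. *)
Fixpoint density_integral (cs : seq (atlas M)) (K : set M)
    (w : atlas M -> 'rV[R]_n -> R) : R :=
  match cs with
  | [::] => 0
  | c :: cs' =>
      integral_rV (fun y => \1_(chart c @` (K `&` dom c)) y * w c y)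
      + density_integral cs' (K `\` dom c) w
  end.

Fixpoint charts_cover (cs : seq (atlas M)) (K : set M) : Prop :=
  match cs with
  | [::] => K = set0
  | c :: cs' => charts_cover cs' (K `\` dom c)
  end.

(* The coordinate domain of a k-th order Lagrangian: all pairs of a point and
   the k-jet there of an inverse metric of signature (p, q). *)
Definition jet_domain (p q k : nat) c : set ('rV[R]_n * jet_type R n k)%type :=
  [set z | exists (U : set M) (h : field) (x : M),
     [/\ open U, inverse_metric p q U h, U x, dom c x &
         z = (chart c x, jet k (h c) (chart c x))]].

Definition lagrangian (k : nat) : Type :=
  atlas M -> ('rV[R]_n * jet_type R n k)%type -> R.

Definition lagrangian_at k (L : lagrangian k) (h : field) : atlas M -> 'rV[R]_n -> R :=
  fun c y => L c (y, jet k (h c) y).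

(* The second condition says that L[h] is a density on M; it relates the
   expressions of one object in two charts and is not an invariance of L under
   diffeomorphisms. *)
Definition local_lagrangian (p q k : nat) (L : lagrangian k) : Prop :=
  (forall c, smooth_on_subset (@jet_domain p q k c) (L c : _ -> R^o)) /\
  (forall (U : set M) (h : field), open U -> inverse_metric p q U h ->
     forall c c' x, U x -> dom c x -> dom c' x ->
       lagrangian_at L h c (chart c x) =
       `|\det (jacobian_at c c' x)| * lagrangian_at L h c' (chart c' x)).

Definition pointwise_local (p q : nat) (E : field -> field) : Prop :=
  exists m : nat, forall (U U' : set M) (h h' : field),
    open U -> open U' -> inverse_metric p q U h -> inverse_metric p q U' h' ->
    forall c x, U x -> U' x -> dom c x ->
      jet m (h c) (chart c x) = jet m (h' c) (chart c x) ->
      E h c (chart c x) = E h' c (chart c x).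

(* h + eps * dh need not be a metric for large eps; only small eps matter for
   the derivative at 0, as dh has compact support. *)
Definition variational_derivative (p q k : nat) (L : lagrangian k)
    (E : field -> field) : Prop :=
  pointwise_local p q E /\
  forall (U : set M) (h : field), open U -> inverse_metric p q U h ->
    (forall c x, U x -> dom c x -> (E h c (chart c x))^T = E h c (chart c x)) /\
    forall dh : field, sym_contra_tensor U dh ->
      let K := tensor_support U dh in
      compact K -> K `<=` U ->
      forall cs, charts_cover cs K ->
        is_derive (0 : R^o) 1
          (fun eps : R^o => density_integral cs K
             (lagrangian_at L (fun c y => h c y + eps *: dh c y)) : R^o)
          (density_integral cs K
             (fun c y => \sum_i \sum_j E h c y i j * dh c y i j)).

Definition tf_einstein : field -> field :=
  fun h c => tf_einstein_density (h c).

End Fields.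

(* Main.v *)
Require Import Defs.
From mathcomp Require Import all_boot all_order all_algebra.
From mathcomp Require Import all_classical all_reals all_analysis.
From mathcomp Require Import ring lra.

Set Implicit Arguments.
Unset Strict Implicit.
Unset Printing Implicit Defensive.

Import Order.TTheory GRing.Theory Num.Theory.
Import numFieldNormedType.Exports.

Local Open Scope classical_set_scope.
Local Open Scope ring_scope.

(* The trace-free tensor E satisfies E_{ab} h^{ab} = 0, so a functional S with
   variational derivative E would be invariant under local conformal rescalings
   h |-> Omega h with Omega - 1 compactly supported.  Differentiating
   S[Omega (eta + t b)] = S[eta + t b] at t = 0, for a flat eta, gives
     int E[Omega eta]_{ab} Omega b^{ab} = int E[eta]_{ab} b^{ab} = 0,
   although a conformally flat metric need not be Einstein when n >= 3:  for
   Omega = v^2 and a <> b,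
     E[v^2 eta]_{ab} = (n - 2) v^{-(n+1)} d_a d_b v.
   We take v = 1 + psi with psi a product of one-variable bumps and
   b = psi (eta + v^{n-1} (d_0 d_1 psi) (e_01 + e_10)), so that the left-hand
   side is 2 (n - 2) int psi (d_0 d_1 psi)^2 > 0.  Both variations are nonzero
   exactly where psi is, so that all actions are integrals over one fixed set and
   neither the regularity nor the integrability of the Lagrangian matters. *)

(** * Calculus of smooth functions *)

Section DifferentiableNear.
Context {R : numFieldType} {V W : normedModType R}.

(** Differentiability depends only on the germ: the first-order expansion of [f] at [x] is also one
    of [g], and uniqueness of the differential identifies its linear part with that of [g]. *)
Lemma near_eq_differentiable (f g : V -> W) (x : V) :
  (\near x, f x = g x) -> differentiable f x -> differentiable g x.
Proof.
move=> fg df; have fgx : f x = g x by exact: nbhs_singleton fg.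
have [dfc /eqaddoP fo] := (diff_locallyP x f).1 df.
have go : g \o shift x = cst (g x) + 'd f x +o_ (0 : V) id.
  have fg0 : \forall z \near (0 : V), f (z + x) = g (z + x).
    by move: fg; rewrite (near_shift (0 : V)) subr0.
  apply/eqaddoP => e e0; rewrite -fgx.
  by apply: filterS2 fg0 (fo e e0) => z fgz; rewrite !fctE /= fgz.
by apply/diff_locallyP; rewrite (diff_unique dfc go).
Qed.

End DifferentiableNear.

Section SmoothCalculus.
Context {R : realType}.
Implicit Types V W : normedModType R.

(** Openness of [U] turns equality on [U] into equality near each point, which is what passes to the
    directional derivatives in the induction. *)
Lemma Ck_on_ext V W k (U : set V) (f g : V -> W) : open U ->
  (forall x, U x -> f x = g x) -> Ck_on k U f -> Ck_on k U g.
Proof.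
move=> oU; elim: k f g => [|k IH] f g fg /=.
  move=> fc x Ux; have nfg : \near x, f x = g x.
    by near=> y; apply: fg; near: y; exact: open_nbhs_nbhs.
  rewrite /prop_for /continuous_at -(fg x Ux).
  exact: cvg_trans (near_eq_cvg nfg) (fc x Ux).
move=> [df Df].
have nfg x : U x -> \near x, f x = g x.
  by move=> Ux; near=> y; apply: fg; near: y; exact: open_nbhs_nbhs.
split=> [x Ux|v]; first exact: near_eq_differentiable (nfg x Ux) (df x Ux).
apply: IH (Df v) => x Ux; exact: near_eq_derive (nfg x Ux).
Unshelve. all: by end_near. Qed.

Lemma Ck_on_pred V W k (U : set V) (f : V -> W) : Ck_on k.+1 U f -> Ck_on k U f.
Proof.
elim: k f => [|k IH] f [df Df] /=.
  by move=> x Ux; exact/differentiable_continuous/df.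
by split=> // v; exact: IH.
Qed.

Lemma Ck_on_cst V W k (U : set V) (a : W) : Ck_on k U (fun=> a).
Proof.
elim: k a => [|k IH] a /=; first by move=> x _; exact: cst_continuous.
split=> [x _|v]; first exact: differentiable_cst.
rewrite (_ : 'D_v _ = fun=> 0); first exact: IH.
by apply/funext => x; rewrite derive_cst.
Qed.

Lemma Ck_onD V W k (U : set V) (f g : V -> W) : open U ->
  Ck_on k U f -> Ck_on k U g -> Ck_on k U (fun x => f x + g x).
Proof.
move=> oU; elim: k f g => [|k IH] f g /=.
  by move=> fc gc x Ux; apply: continuousD; [exact: fc|exact: gc].
move=> [df Df] [dg Dg]; split=> [x Ux|v].
  by apply: differentiableD; [exact: df|exact: dg].
apply: Ck_on_ext oU _ (IH _ _ (Df v) (Dg v)) => x Ux.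
by rewrite -deriveD//; apply: diff_derivable; [exact: df|exact: dg].
Qed.

Lemma Ck_onM V k (U : set V) (f g : V -> R) : open U ->
  Ck_on k U f -> Ck_on k U g -> Ck_on k U (fun x => f x * g x).
Proof.
move=> oU; elim: k f g => [|k IH] f g.
  by move=> /= fc gc x Ux; apply: continuousM; [exact: fc|exact: gc].
move=> Cf Cg; have [[df Df] [dg Dg]] := (Cf, Cg); split=> [x Ux|v].
  by apply: differentiableM; [exact: df|exact: dg].
have := Ck_onD oU (IH _ _ (Ck_on_pred Cf) (Dg v)) (IH _ _ (Ck_on_pred Cg) (Df v)).
apply: Ck_on_ext => // x Ux.
rewrite [RHS]deriveM//; apply: diff_derivable; [exact: df|exact: dg].
Qed.

Lemma Ck_on_sum V W k (U : set V) (I : Type) (s : seq I) (P : pred I)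
    (F : I -> V -> W) : open U -> (forall i, P i -> Ck_on k U (F i)) ->
  Ck_on k U (fun x => \sum_(i <- s | P i) F i x).
Proof.
move=> oU CF; elim: s => [|i s IH].
  by apply: Ck_on_ext oU _ (@Ck_on_cst V W k U 0) => x _; rewrite big_nil.
case: (boolP (P i)) => Pi.
  by apply: Ck_on_ext oU _ (Ck_onD oU (CF i Pi) IH) => x _; rewrite big_cons Pi.
by apply: Ck_on_ext oU _ IH => x _; rewrite big_cons (negbTE Pi).
Qed.

Lemma Ck_on_prod V k (U : set V) (I : Type) (s : seq I) (P : pred I)
    (F : I -> V -> R) : open U -> (forall i, P i -> Ck_on k U (F i)) ->
  Ck_on k U (fun x => \prod_(i <- s | P i) F i x).
Proof.
move=> oU CF; elim: s => [|i s IH].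
  by apply: Ck_on_ext oU _ (@Ck_on_cst V R k U 1) => x _; rewrite big_nil.
case: (boolP (P i)) => Pi.
  by apply: Ck_on_ext oU _ (Ck_onM oU (CF i Pi) IH) => x _; rewrite big_cons Pi.
by apply: Ck_on_ext oU _ IH => x _; rewrite big_cons (negbTE Pi).
Qed.

Lemma Ck_onX V k (U : set V) (f : V -> R) m : open U ->
  Ck_on k U f -> Ck_on k U (fun x => f x ^+ m).
Proof.
move=> oU Cf; elim: m => [|m IH].
  by apply: Ck_on_ext oU _ (@Ck_on_cst V R k U 1) => x _; rewrite expr0.
by apply: Ck_on_ext oU _ (Ck_onM oU Cf IH) => x _; rewrite exprS.
Qed.

Lemma differentiable_mxP V m n (f : V -> 'M[R]_(m, n)) x :
  differentiable f x <-> forall i j, differentiable (fun y => f y i j) x.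
Proof.
split=> [df i j|df].
  exact: (@differentiable_comp _ _ _ _ f (fun N : 'M[R]_(m, n) => N i j : R)
    x df (differentiable_coord _ _ _)).
have -> : f = fun y => \sum_i \sum_j f y i j *: delta_mx i j.
  by apply/funext => y; exact: matrix_sum_delta.
have Esum I (s : seq I) (F : I -> V -> 'M[R]_(m, n)) :
  (forall i, differentiable (F i) x) ->
  differentiable (fun y => \sum_(i <- s) F i y) x.
  move=> dF; elim: s => [|i s IH].
    rewrite (_ : (fun _ => _) = cst 0); first exact: differentiable_cst.
    by apply/funext => y; rewrite big_nil.
  rewrite (_ : (fun _ => _) = F i + fun y => \sum_(j <- s) F j y).
    exact: differentiableD.
  by apply/funext => y; rewrite big_cons.
by apply: (Esum) => i; apply: (Esum) => j; exact: differentiableZl.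
Qed.

Lemma derive_mxE V m n (f : V -> 'M[R]_(m, n)) x v i j : derivable f x v ->
  'D_v f x i j = 'D_v (fun y => f y i j) x.
Proof. by move=> df; rewrite derive_mx// mxE. Qed.

Lemma Ck_on_mxP V m n k (U : set V) (f : V -> 'M[R]_(m, n)) : open U ->
  Ck_on k U f <-> forall i j, Ck_on k U (fun y => f y i j).
Proof.
move=> oU; elim: k f => [|k IH] f /=.
  split=> [fc i j x Ux|fc x Ux].
    exact: (@continuous_comp _ _ _ f (fun N : 'M[R]_(m, n) => N i j : R) x
      (fc x Ux) (@coord_continuous _ _ _ _ _ _)).
  have -> : f = fun y => \sum_i \sum_j f y i j *: delta_mx i j.
    by apply/funext => y; exact: matrix_sum_delta.
  apply: (@Ck_on_sum V 'M[R]_(m, n) 0 U _ _ _ (fun i y =>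
    \sum_j f y i j *: delta_mx i j) oU _ x Ux) => i _.
  apply: (@Ck_on_sum V 'M[R]_(m, n) 0 U _ _ _ (fun j y =>
    f y i j *: delta_mx i j) oU _) => j _ y Uy.
  by apply: continuousZr_tmp; exact: fc.
split=> [[df Df] i j|Cf].
  split=> [x Ux|v]; first by move: i j; apply/differentiable_mxP/df.
  have := (IH _).1 (Df v) i j; apply: Ck_on_ext => // x Ux.
  by rewrite derive_mxE//; exact/diff_derivable/df.
have df x : U x -> differentiable f x.
  by move=> Ux; apply/differentiable_mxP => i j; exact: (Cf i j).1.
split=> // v; apply/IH => i j; have := (Cf i j).2 v.
by apply: Ck_on_ext => // x Ux; rewrite derive_mxE//; exact/diff_derivable/df.
Qed.

Lemma derive_comp_rV V n (W : normedModType R) (f : V -> 'rV[R]_n)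
    (g : 'rV[R]_n -> W) x v :
  differentiable f x -> differentiable g (f x) ->
  'D_v (g \o f) x = \sum_i ('D_v f x) 0 i *: partial i g (f x).
Proof.
move=> df dg; have dgf : differentiable (g \o f) x by exact: differentiable_comp.
rewrite deriveE// diff_comp//= -(deriveE v df).
move: ('D_v f x) => u; rewrite [in LHS](row_sum_delta u) (linear_sum ('d g (f x))).
apply: eq_bigr => i _.
by rewrite linearZ/= /partial deriveE.
Qed.

(** By the chain rule a directional derivative of [g \o f] is a sum of products of coordinates of
    ['D_v f] with partial derivatives of [g] composed with [f]; the induction hypothesis covers the
    latter. *)
Lemma Ck_on_comp V n k (U : set V) (U' : set 'rV[R]_n) (f : V -> 'rV[R]_n)
    (g : 'rV[R]_n -> R) : open U -> open U' -> (forall x, U x -> U' (f x)) ->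
  Ck_on k U f -> Ck_on k U' g -> Ck_on k U (g \o f).
Proof.
move=> oU oU' UU'; elim: k f g UU' => [|k IH] f g UU'.
  by move=> /= fc gc x Ux; apply: continuous_comp; [exact: fc|exact/gc/UU'].
move=> Cf Cg; have [[df Df] [dg Dg]] := (Cf, Cg); split=> [x Ux|v].
  by apply: differentiable_comp; [exact: df|exact/dg/UU'].
have : Ck_on k U (fun x => \sum_i ('D_v f x) 0 i * partial i g (f x)).
  apply: Ck_on_sum => // i _; apply: Ck_onM => //.
    by move: i; have := (Ck_on_mxP k ('D_v f) oU).1 (Df v) 0.
  exact: IH (Ck_on_pred Cf) (Dg _).
apply: Ck_on_ext => // x Ux.
by rewrite derive_comp_rV//; [exact: df|exact/dg/UU'].
Qed.

(** [G] lists a function of one variable together with its successive derivatives, so that its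
    smoothness is given by explicit formulas. *)
Lemma Ck_on_comp1 V k (U : set V) (f : V -> R) (G : nat -> R -> R) :
  open U -> (forall j (x : R), is_derive x 1 (G j) (G j.+1 x)) ->
  Ck_on k U f -> Ck_on k U (G 0 \o f).
Proof.
move=> oU dG.
have dfG j x : differentiable (G j) x by apply/derivable1_diffP; have [] := dG j x.
(* Differentiating [G j \o f] produces [G j.+1 \o f], so the induction on [k] has to treat all [j]
   at once. *)
have : forall j, Ck_on k U f -> Ck_on k U (G j \o f); last by exact.
elim: k => [|k IH] j.
  move=> /= fc x Ux; apply: continuous_comp; first exact: fc.
  exact/differentiable_continuous.
move=> Cf; have [df Df] := Cf; split=> [x Ux|v].
  by apply: differentiable_comp => //; exact: df.
have := Ck_onM oU (Df v) (IH j.+1 (Ck_on_pred Cf)).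
apply: Ck_on_ext => // x Ux /=.
have dfx := df x Ux; have dGj := dfG j (f x).
have dgf : differentiable (G j \o f) x by exact: differentiable_comp.
rewrite (deriveE _ dgf) diff_comp//= -(deriveE _ dfx).
rewrite -[X in _ = 'd _ _ X]mulr1 -[X in _ = 'd _ _ X]/(_ *: _) linearZ/=.
by rewrite -deriveE// (derive_val (is_derive:=dG j _)).
Qed.

Lemma linear_Ck_on V W k (U : set V) (f : {linear V -> W}) :
  continuous f -> Ck_on k U f.
Proof.
move=> fc; case: k => [|k] /=; first by move=> x _; exact: fc.
split=> [x _|v]; first exact: linear_differentiable.
rewrite (_ : 'D_v f = fun=> f v); first exact: Ck_on_cst.
by apply/funext => x; rewrite deriveE ?diff_lin//; exact: linear_differentiable.
Qed.

Lemma coord_Ck_on m n k (U : set 'M[R]_(m, n)) i j :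
  Ck_on k U (fun N : 'M[R]_(m, n) => N i j).
Proof.
have @f : {linear 'M[R]_(m, n) -> R}.
  by exists (fun N : 'M[R]_(_, _) => N i j); do 2![eexists]; do ?[constructor];
     rewrite ?mxE// => ? *; rewrite ?mxE//; move=> ?; rewrite !mxE.
rewrite (_ : (fun _ => _) = f) //; exact/linear_Ck_on/coord_continuous.
Qed.

End SmoothCalculus.

(** * Bump functions *)

Section FlatFunction.
Context {R : realType}.
Implicit Types (x y : R) (p : {poly R}).

(** Raise [expR (y / m.+1) >= 1 + y / m.+1 > y / m.+1] to the power [m.+1]; the spare factor [y]
    gives the decay in [1 / y]. *)
Lemma exprMexpRN_le m y : 0 < y -> y ^+ m * expR (- y) <= m.+1%:R ^+ m.+1 / y.
Proof.
move=> y0; have m0 : 0 < m.+1%:R :> R by [].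
rewrite expRN ler_pdivrMr ?expR_gt0// mulrAC ler_pdivlMr//.
rewrite -exprSr -ler_pdivrMl ?exprn_gt0// mulrC -expr_div_n.
have -> : expR y = expR (y / m.+1%:R) ^+ m.+1.
  by rewrite -expRM_natr divfK// gt_eqF.
apply: lerXn2r; rewrite ?nnegrE ?expR_ge0 ?divr_ge0 ?ltW//.
by apply: lt_le_trans (expR_ge1Dx _); rewrite ltrDr ltr01.
Qed.

Lemma hornerMexpRN_le p : exists C : R, forall y, 0 < y ->
  `|p.[y] * expR (- y)| <= C / y.
Proof.
exists (\sum_(i < size p) `|p`_i| * i.+1%:R ^+ i.+1) => y y0.
rewrite horner_coef mulr_suml mulr_suml.
apply: le_trans (ler_norm_sum _ _ _) _; apply: ler_sum => i _.
rewrite -mulrA normrM -mulrA ler_wpM2l// ger0_norm ?exprMexpRN_le//.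
by rewrite mulr_ge0 ?exprn_ge0 ?expR_ge0// ltW.
Qed.

(** The polynomial parameter makes the family closed under differentiation; [flat 1] is the
    classical smooth function that vanishes to infinite order at 0. *)
Definition flat p x : R := if 0 < x then p.[x^-1] * expR (- x^-1) else 0.

(** For positive [x] this is the product rule for [p(1/x) exp(-1/x)]; for negative [x] the function
    is locally zero; at 0 the exponential beats every polynomial in [1/x]. *)
Lemma is_derive_flat p x :
  is_derive x 1 (flat p) (flat ('X^2 * (p - p^`()))%R x).
Proof.
have [x0|x0|->] := ltgtP x 0.
- rewrite {2}/flat ltNge (ltW x0)/=.
  apply: (@near_eq_is_derive _ _ _ (fun=> 0)) (is_derive_cst _ _ _).
  near=> z; rewrite /flat ifF//; apply/negbTE; rewrite -leNgt ltW//.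
  by near: z; exact: lt_nbhsl.
- rewrite {2}/flat x0.
  apply: (@near_eq_is_derive _ _ _ ((horner p \o GRing.inv) * (expR \o (-%R \o GRing.inv)))).
    by near=> z; rewrite /flat !fctE ifT//; near: z; exact: lt_nbhsr.
  have dinv : is_derive x 1 (@GRing.inv R) (- x ^- 2).
    have := @is_deriveV R id x 1 1 (lt0r_neq0 x0) (is_derive_id _ _).
    by rewrite /= [_ *: _]mulr1.
  have dN : is_derive x 1 (-%R \o @GRing.inv R) (- (- x ^- 2)) by exact: is_deriveN.
  have dp := is_derive1_comp (is_derive_poly p x^-1) dinv.
  have de := @is_derive1_comp R expR (-%R \o GRing.inv) x _ _ (is_derive_expR _) dN.
  apply: is_derive_eq (is_deriveM dp de) _.
  rewrite /= opprK !hornerE /= exprVn /GRing.scale/=; ring.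
(* For positive [h] the difference quotient at 0 is [('X * p).[y] * expR (- y)] with [y = h^-1],
   hence at most [C * h] in absolute value. *)
rewrite {2}/flat ltxx; have [C pC] := hornerMexpRN_le ('X * p).
have lim0 : h^-1 *: (flat p (h *: 1 + 0) - flat p 0) @[h --> 0^'] --> (0 : R).
  apply/cvgrPdist_le => e e0; near=> h.
  have h0 : h != 0 by near: h; exact: nbhs_dnbhs_neq.
  rewrite sub0r normrN addr0 /flat ltxx subr0 [h *: 1]mulr1.
  case: ifPn => [hgt|_]; last by rewrite scaler0 normr0 ltW.
  have := pC h^-1; rewrite invr_gt0 hornerM hornerX => /(_ hgt).
  rewrite -mulrA invrK => /le_trans; apply.
  have hC : `|h| <= e / (`|C| + 1).
    by near: h; apply: dnbhs0_le; rewrite divr_gt0// ltr_wpDl.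
  rewrite gtr0_norm// ler_pdivlMr ?ltr_wpDl// in hC.
  apply: le_trans hC; rewrite mulrC ler_pM2l//.
  by rewrite (le_trans (ler_norm _))// lerDl.
by apply: DeriveDef; [apply/cvg_ex; exists 0|apply/cvg_lim].
Unshelve. all: by end_near. Qed.

End FlatFunction.

Section Bump.
Context {R : realType}.
Implicit Types (x y a r : R).

Lemma Ck_on_flat (V : normedModType R) k (U : set V) (f : V -> R) (p : {poly R}) :
  open U -> Ck_on k U f -> Ck_on k U (flat p \o f).
Proof.
move=> oU Cf.
apply: (Ck_on_comp1 (G := fun j => flat (iter j (fun q => 'X^2 * (q - q^`())) p))) => //.
by move=> j x; exact: is_derive_flat.
Qed.

Lemma flat1E x : flat 1 x = if 0 < x then expR (- x^-1) else 0.
Proof. by rewrite /flat hornerC mul1r. Qed.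

Lemma flat1_ge0 x : 0 <= flat 1 x.
Proof. by rewrite flat1E; case: ifP; rewrite ?expR_ge0. Qed.

Lemma flat1_gt0 x : (0 < flat 1 x) = (0 < x).
Proof. by rewrite flat1E; case: ifP; rewrite ?expR_gt0 ?ltxx. Qed.

Definition dflat1 : R -> R := flat ('X^2 * (1 - 1^`())).

Lemma dflat1E x : 0 < x -> dflat1 x = x ^- 2 * flat 1 x.
Proof.
have d1 : 1^`() = 0 :> {poly R} by rewrite -[1]polyC1 derivC.
by move=> x0; rewrite /dflat1 flat1E /flat x0 d1 !hornerE /= subr0 mulr1 exprVn.
Qed.

Definition bump a r x := flat 1 (r + (x - a)) * flat 1 (r - (x - a)).

Definition dbump a r x :=
  flat 1 (r - (x - a)) * dflat1 (r + (x - a))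
  - flat 1 (r + (x - a)) * dflat1 (r - (x - a)).

Lemma is_derive_rplus a r x : is_derive x 1 (fun y => r + (y - a)) 1.
Proof.
have := is_deriveD (is_derive_cst r x 1)
  (is_deriveB (is_derive_id x 1) (is_derive_cst a x 1)).
by rewrite subr0 add0r.
Qed.

Lemma is_derive_rminus a r x : is_derive x 1 (fun y => r - (y - a)) (-1).
Proof.
have := is_deriveB (is_derive_cst r x 1)
  (is_deriveB (is_derive_id x 1) (is_derive_cst a x 1)).
by rewrite subr0 sub0r.
Qed.

Lemma is_derive_bump a r x : is_derive x 1 (bump a r) (dbump a r x).
Proof.
have dp := is_derive_rplus a r x; have dm := is_derive_rminus a r x.
have fp := @is_derive1_comp R (flat 1) _ x _ _ (is_derive_flat _ _) dp.
have fm := @is_derive1_comp R (flat 1) _ x _ _ (is_derive_flat _ _) dm.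
apply: is_derive_eq (is_deriveM fp fm) _.
by rewrite /dbump /dflat1 /GRing.scale/= mulr1 mulrN1 mulrN addrC.
Qed.

Lemma bump_ge0 a r x : 0 <= bump a r x.
Proof. by rewrite mulr_ge0 ?flat1_ge0. Qed.

Lemma bump_gt0 a r x : (0 < bump a r x) = (`|x - a| < r).
Proof.
rewrite ltr_norml lt_def bump_ge0 andbT mulf_eq0 negb_or.
have E z : (flat 1 z != 0) = (0 < z :> R) by rewrite -flat1_gt0 lt_def flat1_ge0 andbT.
by rewrite !E subr_gt0 -ltrBlDl sub0r.
Qed.

Lemma bump_eq0 a r x : (bump a r x == 0) = ~~ (`|x - a| < r).
Proof. by rewrite -bump_gt0 lt_def bump_ge0 andbT negbK. Qed.

(** Halfway to the right edge the two arguments are [3r/2] and [r/2]. By [dflat1E] the derivative is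
    a product of positive values times the difference of the inverse squares of these arguments,
    which is negative. *)
Lemma dbump_neq0 a r : 0 < r -> dbump a r (a + r / 2) != 0.
Proof.
move=> r0; rewrite /dbump [a + _]addrC addrK.
have p1 : 0 < r + r / 2 by lra.
have p2 : 0 < r - r / 2 by lra.
rewrite !dflat1E// mulrCA [X in _ - X]mulrCA [flat 1 (r - _) * _]mulrC -mulrBl.
rewrite mulf_neq0//; last by rewrite mulf_neq0// gt_eqF// flat1_gt0.
rewrite subr_eq0 lt_eqF// ltf_pV2 ?posrE ?exprn_gt0//.
rewrite ltrXn2r ?nnegrE ?ltW//; lra.
Qed.

Lemma is_derive_continuous (f : R -> R) (df : R -> R) :
  (forall x, is_derive x 1 f (df x)) -> continuous f.
Proof.
move=> fdf x; apply/differentiable_continuous/derivable1_diffP.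
by have [] := fdf x.
Qed.

Lemma continuous_flat (p : {poly R}) : continuous (flat p).
Proof. exact: is_derive_continuous (is_derive_flat p). Qed.

Lemma continuous_bump a r : continuous (bump a r).
Proof. exact: is_derive_continuous (is_derive_bump a r). Qed.

Lemma continuous_dbump a r : continuous (dbump a r).
Proof.
have cp := is_derive_continuous (is_derive_rplus a r).
have cm := is_derive_continuous (is_derive_rminus a r).
have cfp p x : {for x, continuous (flat p \o fun y => r + (y - a))}.
  by apply: continuous_comp; [exact: cp|exact: continuous_flat].
have cfm p x : {for x, continuous (flat p \o fun y => r - (y - a))}.
  by apply: continuous_comp; [exact: cm|exact: continuous_flat].
move=> x; rewrite -[dbump a r]/((flat 1 \o fun y => r - (y - a)) * (flat _ \o fun y => r + (y - a))
  - (flat 1 \o fun y => r + (y - a)) * (flat _ \o fun y => r - (y - a))).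
apply: continuousB; apply: continuousM; solve [exact: cfp|exact: cfm].
Qed.

End Bump.

(** * Positivity of integrals and integrals of separated functions *)

Section IntegralPositive.
Context {R : realType}.
Let mu := @lebesgue_measure R.

Lemma continuous_integrable_itv (k : R -> R) (a b : R) : continuous k ->
  (forall x, k x != 0 -> a <= x <= b) -> mu.-integrable setT (EFin \o k).
Proof.
move=> ck k0; have /integrable_mkcond : mu.-integrable `[a, b] (EFin \o k).
  apply: continuous_compact_integrable; first exact: segment_compact.
  exact: continuous_subspaceT.
move=> /(_ (measurable_itv _)).
rewrite restrict_EFin (_ : k \_ _ = k)//; apply/funext => x; rewrite patchE.
case: ifPn => // /negP xab; apply/esym/eqP/negPn/negP => kx; apply: xab.
by rewrite inE/= in_itv/= k0.
Qed.

(** By continuity [k] exceeds [k x / 2] on an interval around [x], which bounds the integral from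
    below; the bounded support makes the integral finite, so that [fine] keeps it positive. *)
Lemma Rintegral_continuous_gt0 (k : R -> R) (a b x : R) : continuous k ->
  (forall x, 0 <= k x) -> (forall x, k x != 0 -> a <= x <= b) -> 0 < k x ->
  0 < \int[mu]_x k x.
Proof.
move=> ck k_ge0 k0 kx; have ik := continuous_integrable_itv ck k0.
have : \forall y \near x, k x / 2 < k y.
  have := ck x; rewrite /continuous_at => /cvgr_gt; apply.
  by rewrite ltr_pdivrMr// ltr_pMr// ltr1n.
move=> /nbhs_ballP[e /= e0 ke].
(* Half the radius keeps the closed interval inside the open ball; its length is [e]. *)
pose I := `[x - e / 2, x + e / 2]%classic.
have mI : measurable I by exact: measurable_itv.
have e2 : 0 < e / 2 by rewrite divr_gt0.
have muI : mu I = (e%:E).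
  rewrite /mu lebesgue_measure_itv/= lte_fin ltrBlDr -addrA ltrDl -splitr e0.
  by rewrite -EFinB; congr EFin; lra.
have : ((k x / 2)%:E * e%:E <= \int[mu]_y (k y)%:E)%E.
  rewrite -muI -integral_cst//.
  apply: (@le_trans _ _ (\int[mu]_(y in I) (k y)%:E)%E).
    apply: ge0_le_integral => //=.
    - by move=> *; rewrite lee_fin divr_ge0// ltW.
    - have := @measurable_int _ _ _ mu _ _ ik.
      by apply: measurable_funS => //; exact: measurableT.
    - move=> y; rewrite /I/= in_itv/= => /andP[y1 y2]; rewrite lee_fin ltW// ke//.
      by rewrite /ball/= ltr_norml; lra.
  apply: ge0_subset_integral => //=.
    exact: measurable_int ik.
  by move=> y _; rewrite lee_fin.
rewrite -EFinM => h; rewrite /Rintegral fine_gt0//; apply/andP; split.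
  by apply: lt_le_trans h; rewrite lte_fin mulr_gt0// divr_gt0.
exact: integrable_lty.
Qed.

(** The constant [c] is there for the induction: the value [f ord0 x] of the first factor is
    absorbed into it while the remaining coordinates are integrated. *)
Lemma integral_rV_prod n (c : R) (f : 'I_n -> R -> R) :
  (forall i, mu.-integrable setT (EFin \o f i)) ->
  integral_rV (fun y => c * \prod_i f i (y 0 i)) = c * \prod_i \int[mu]_x f i x.
Proof.
elim: n c f => [|n IH] c f fi; first by rewrite /= !big_ord0.
rewrite big_ord_recl /=.
have E x : integral_rV (fun v : 'rV[R]_n => c * \prod_i f i
    ((row_mx (x%:M : 'rV[R]_1) v : 'rV[R]_n.+1) 0 i)) =
    (c * \prod_i \int[mu]_x f (lift ord0 i) x) * f ord0 x.
  have := IH (c * f ord0 x) (fun i => f (lift ord0 i)) (fun i => fi _).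
  rewrite mulrAC => <-; congr integral_rV; apply/funext => v.
  rewrite big_ord_recl mulrA; congr (_ * f _ _ * _).
    have -> : (ord0 : 'I_(1 + n)) = lshift n ord0 by exact: val_inj.
    by rewrite (row_mxEl (x%:M : 'rV_1) v 0 ord0) mxE eqxx.
  apply: eq_bigr => i _; congr f.
  have -> : (lift ord0 i : 'I_(1 + n)) = rshift 1 i by exact: val_inj.
  by rewrite (row_mxEr (x%:M : 'rV_1) v 0 i).
rewrite (_ : (fun x => _) = fun x =>
  (c * \prod_i \int[mu]_x f (lift ord0 i) x) * f ord0 x); last exact/funext.
by rewrite RintegralZl// -mulrA [X in c * X]mulrC.
Qed.

End IntegralPositive.

Section ProductFunction.
Context {R : realType} {n : nat}.
Implicit Types (f : 'I_n -> R -> R) (y : 'rV[R]_n).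

Definition prod_fun f y : R := \prod_i f i (y 0 i).

(** Only the [i]-th factor changes along the [i]-th axis, so the difference quotient is that of
    [f i] times the constant [P]. *)
Lemma partial_prod_fun f (i : 'I_n) (df : R -> R) :
  (forall x : R, is_derive x 1 (f i) (df x)) ->
  partial i (prod_fun f) = prod_fun (fun j => if j == i then df else f j).
Proof.
move=> fdf; apply/funext => y; rewrite /partial /derive.
pose P := \prod_(j | j != i) f j (y 0 j).
have E h : prod_fun f (h *: delta_mx 0 i + y) = f i (h *: 1 + y 0 i) * P.
  rewrite /prod_fun (bigD1 i)//= !mxE !eqxx [h *: 1]/(_ * _); congr (_ * _).
  by apply: eq_bigr => j ji; rewrite !mxE (negbTE ji) mulr0 add0r.
rewrite (_ : (fun _ => _) = fun h =>
    h^-1 *: (f i (h *: 1 + y 0 i) - f i (y 0 i)) * P); last first.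
  have E0 : prod_fun f y = f i (y 0 i) * P.
    by have := E 0; rewrite !scale0r !add0r.
  by apply/funext => h; rewrite /= E E0 -mulrBl scalerAl.
apply/cvg_lim => //; rewrite /prod_fun (bigD1 i)//= eqxx.
have -> : \prod_(j | j != i) (if j == i then df else f j) (y 0 j) = P.
  by apply: eq_bigr => j /negbTE ->.
have [dfi <-] := fdf (y 0 i); apply: cvgM; [exact: dfi|exact: cvg_cst].
Qed.

Lemma Ck_on_prod_fun f k :
  (forall i, Ck_on k setT (fun y => f i (y 0 i))) -> Ck_on k setT (prod_fun f).
Proof. by move=> Cf; apply: Ck_on_prod => //; exact: openT. Qed.

End ProductFunction.

Section BumpRow.
Context {R : realType} {n : nat}.

Lemma rV_box_subset (V : set 'rV[R]_n) (a : 'rV[R]_n) : open V -> V a ->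
  exists2 r : R, 0 < r & [set y : 'rV[R]_n | forall i, `|y 0 i - a 0 i| <= r] `<=` V.
Proof.
move=> oV Va; have /nbhs_ballP[e /= e0 eV] := open_nbhs_nbhs (conj oV Va).
have e2 : 0 < e / 2 by rewrite divr_gt0.
exists (e / 2) => // y /= ye; apply: eV; rewrite -ball_normE /=.
apply: (@le_lt_trans _ _ (e / 2)); last by rewrite ltr_pdivrMr// ltr_pMr// ltr1n.
rewrite [leLHS]/Num.Def.normr/= mx_normrE (bigmax_le _ (ltW e2))//= => -[k l] _ /=.
by rewrite !mxE ord1 distrC.
Qed.

Lemma rV_box_compact (a : 'rV[R]_n) (r : R) :
  compact [set y : 'rV[R]_n | forall i, `|y 0 i - a 0 i| <= r].
Proof.
have := @rV_compact R n (fun i => `[a 0 i - r, a 0 i + r]%classic)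
  (fun i => @segment_compact R _ _).
congr compact; apply/seteqP; split=> y /= h i; have := h i; rewrite in_itv/= ler_distl//.
Qed.

(** General [p] and [q] cover at once the bump and both terms of its derivative. *)
Lemma coord_bump_Ck_on (i : 'I_n) (a r : R) (p q : {poly R}) k :
  Ck_on k setT (fun y : 'rV[R]_n =>
    flat p (r + (y 0 i - a)) * flat q (r - (y 0 i - a))).
Proof.
have oT := @openT 'rV[R]_n.
have Cy : Ck_on k setT (fun y : 'rV[R]_n => y 0 i - a).
  exact: (Ck_onD oT (@coord_Ck_on R 1 n k setT 0 i) (@Ck_on_cst R _ R k setT (- a))).
have CNy : Ck_on k setT (fun y : 'rV[R]_n => - (y 0 i - a)).
  have := Ck_onM oT (@Ck_on_cst R _ R k setT (-1)) Cy.
  by apply: Ck_on_ext => // x _; rewrite mulN1r.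
have Cr := @Ck_on_cst R 'rV[R]_n R k setT r.
apply: Ck_onM => //; first exact: (Ck_on_flat p oT (Ck_onD oT Cr Cy)).
exact: (Ck_on_flat q oT (Ck_onD oT Cr CNy)).
Qed.

Lemma bump_Ck_on (i : 'I_n) (a r : R) k :
  Ck_on k setT (fun y : 'rV[R]_n => bump a r (y 0 i)).
Proof. exact: coord_bump_Ck_on. Qed.

Lemma dbump_Ck_on (i : 'I_n) (a r : R) k :
  Ck_on k setT (fun y : 'rV[R]_n => dbump a r (y 0 i)).
Proof.
have oT := @openT 'rV[R]_n.
have := Ck_onM oT (@Ck_on_cst R _ R k setT (-1)) (coord_bump_Ck_on i a r 1 ('X^2 * (1 - 1^`())) k).
move=> /(Ck_onD oT (coord_bump_Ck_on i a r ('X^2 * (1 - 1^`())) 1 k)).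
by apply: Ck_on_ext => // x _; rewrite /dbump /dflat1 mulN1r [X in X - _]mulrC.
Qed.

(** Take for [psi] a product of one-variable bumps on a small box; [kappa] replaces the factors [i]
    and [j] by their derivatives. The integrand is then again separated, and its integral is a
    product of positive one-variable integrals. *)
Lemma separated_bump (i j : 'I_n) (V : set 'rV[R]_n) (a : 'rV[R]_n) :
  i != j -> open V -> V a -> exists psi kappa : 'rV[R]_n -> R,
  [/\ smooth_on setT psi /\ smooth_on setT kappa,
      forall y, 0 <= psi y,
      partial i (partial j psi) = kappa /\ partial j (partial i psi) = kappa,
      exists2 K, compact K & K `<=` V /\ forall y, psi y != 0 -> K y &
      forall c, 0 < c -> 0 < integral_rV (fun y => c * (psi y * kappa y ^+ 2))].
Proof.
move=> ij oV Va; have [r r0 rV] := rV_box_subset oV Va.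
pose f k := bump (a 0 k) r; pose df k := dbump (a 0 k) r.
pose g (k : 'I_n) := if (k == i) || (k == j) then df k else f k.
have dfk k (x : R) : is_derive x 1 (f k) (df k x) by exact: is_derive_bump.
exists (prod_fun f), (prod_fun g); split.
- split=> k; apply: Ck_on_prod_fun => l; first exact: bump_Ck_on.
  by rewrite /g; case: ifP => _; [exact: dbump_Ck_on|exact: bump_Ck_on].
- by move=> y; apply: prodr_ge0 => k _; exact: bump_ge0.
- have pp (k l : 'I_n) : k != l -> partial k (partial l (prod_fun f)) =
      prod_fun (fun m => if m == k then df k else if m == l then df l else f m).
    move=> kl; rewrite (partial_prod_fun (dfk l)).
    pose f' m := if m == l then df l else f m.
    apply: (@partial_prod_fun _ _ f' k (df k)) => x.
    by rewrite /f' (negbTE kl).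
  have ji : j != i by rewrite eq_sym.
  split; rewrite pp//; congr prod_fun; apply/funext => k; rewrite /g.
    by case: eqP => [->|]//=; case: eqP => // ->.
  by case: eqP => [->|]; [rewrite orbT|rewrite orbF; case: eqP => // ->].
- exists [set y : 'rV[R]_n | forall i, `|y 0 i - a 0 i| <= r]; first exact: rV_box_compact.
  split=> // y /prodf_neq0 fy k; have := fy k isT.
  by rewrite bump_eq0 negbK => /ltW.
- move=> c c0; pose h k x := f k x * (g k x * g k x).
  have ch k : continuous (h k).
    have cg : continuous (g k).
      by rewrite /g; case: ifP => _; [exact: continuous_dbump|exact: continuous_bump].
    move=> x; apply: continuousM; first exact: continuous_bump.
    by apply: continuousM; exact: cg.
  have h0 k x : h k x != 0 -> a 0 k - r <= x <= a 0 k + r.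
    by rewrite mulf_eq0 negb_or bump_eq0 negbK -ler_distl => /andP[/ltW].
  have E : (fun y => c * (prod_fun f y * prod_fun g y ^+ 2)) =
           fun y : 'rV[R]_n => c * \prod_k h k (y 0 k).
    by apply/funext => y; rewrite expr2 /h /prod_fun -!big_split.
  rewrite E (@integral_rV_prod R n c h); last first.
    move=> k; exact: continuous_integrable_itv (ch k) (h0 k).
  rewrite mulr_gt0//; apply: prodr_gt0 => k _.
  (* The test point lies off centre because the derivative of the bump vanishes at the centre. *)
  apply: (Rintegral_continuous_gt0 (x := a 0 k + r / 2) (ch k) _ (h0 k)).
    by move=> x; rewrite mulr_ge0 ?bump_ge0// -expr2 sqr_ge0.
  have fk : 0 < f k (a 0 k + r / 2).
    by rewrite bump_gt0 [a 0 k + _]addrC addrK gtr0_norm ?divr_gt0//; lra.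
  rewrite mulr_gt0// -expr2 lt_def sqr_ge0 andbT expf_neq0// /g.
  by case: ifP => _; [exact: dbump_neq0|rewrite gt_eqF].
Qed.

End BumpRow.

(** * Curvature of conformally flat metrics *)

Section ConformalChristoffelAlgebra.
Context {R : comPzRingType} {n : nat}.
Variables (e l : 'I_n -> R).
Hypothesis e2 : forall a, e a * e a = 1.

Lemma sum_delta (b : 'I_n) (f : 'I_n -> R) : \sum_a (a == b)%:R * f a = f b.
Proof.
rewrite (bigD1 b)//= eqxx mul1r big1 ?addr0// => a /negbTE ->.
by rewrite mul0r.
Qed.

Lemma sum_delta2 (b d : 'I_n) (f g : 'I_n -> R) :
  \sum_a ((a == b)%:R * f a + (a == d)%:R * g a) = f b + g d.
Proof. by rewrite big_split/= !sum_delta. Qed.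

(* The Christoffel symbols of the metric v^-2 diag(e), for l the gradient of
   - ln v. *)
Definition conformal_christoffel (a b c : 'I_n) : R :=
  (a == c)%:R * l b + (a == b)%:R * l c - e a * e b * (b == c)%:R * l a.

Local Notation G := conformal_christoffel.

(** For each [a] the term in [l a] cancels and [l b] remains. The result is the gradient of the
    logarithm of the volume density [v^-n]. *)
Lemma sum_conformal_christoffel b : \sum_a G a a b = n%:R * l b.
Proof.
have E a : G a a b = l b.
  by rewrite /G eqxx mul1r e2 mul1r addrAC subrr add0r.
by rewrite (eq_bigr _ (fun a _ => E a)) sumr_const card_ord mulr_natl.
Qed.

Lemma conformal_christoffel_neq a b d : b != d ->
  G a d b = (a == b)%:R * l d + (a == d)%:R * l b.
Proof. by move=> bd; rewrite /G [d == b]eq_sym (negbTE bd) mulr0n; ring. Qed.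

Lemma sum_mul_conformal_christoffel (f : 'I_n -> R) b d : b != d ->
  \sum_a f a * G a d b = f b * l d + f d * l b.
Proof.
move=> bd; rewrite -(sum_delta b (fun a => f a * l d)) -(sum_delta d (fun a => f a * l b)).
rewrite -big_split; apply: eq_bigr => a _ /=.
by rewrite conformal_christoffel_neq//; ring.
Qed.

(** Off the diagonal the first contraction gives [2n l_b l_d] and the second [(n + 2) l_b l_d]. *)
Lemma conformal_ricci_quadratic b d : b != d ->
  \sum_a (\sum_c G a a c * G c d b - \sum_c G a d c * G c a b) =
  (n%:R - 2) * (l b * l d).
Proof.
move=> bd; rewrite sumrB exchange_big/=.
under eq_bigr do rewrite -mulr_suml sum_conformal_christoffel.
rewrite (sum_mul_conformal_christoffel (fun c => n%:R * l c) bd).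
(* The three terms of [G a d c] are summed separately over [c]; the first two contribute [n l_b l_d]
   and [2 l_b l_d], the third nothing. *)
have E a : \sum_c G a d c * G c a b =
    l d * G a a b + (a == d)%:R * (\sum_c l c * G c a b) - e a * e d * l a * G d a b.
  rewrite -[l d * _](sum_delta a (fun c => l d * G c a b)).
  rewrite -[e a * _ * _ * _](sum_delta d (fun c => e a * e d * l a * G c a b)).
  rewrite mulr_sumr -sumrN -!big_split; apply: eq_bigr => c _ /=.
  by rewrite {1}/G [c == a]eq_sym [c == d]eq_sym; ring.
rewrite (eq_bigr _ (fun a _ => E a)) big_split/= sumrN big_split/= -mulr_sumr.
rewrite sum_conformal_christoffel (sum_delta d) sum_mul_conformal_christoffel//.
have -> : \sum_a e a * e d * l a * G d a b = 0.
  have F a : e a * e d * l a * G d a b =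
      (a == d)%:R * (e a * e d * l a * l b)
      - (a == b)%:R * ((e a * e a) * (e d * e d) * l a * l d).
    by rewrite /G [d == b]eq_sym (negbTE bd) [d == a]eq_sym mulr0n; ring.
  rewrite (eq_bigr _ (fun a _ => F a)) big_split/= sumrN !sum_delta !e2; ring.
ring.
Qed.

End ConformalChristoffelAlgebra.

Lemma sqrt_norm_detZ (R : realType) n (a : R) (A : 'M[R]_n) : 0 <= a ->
  `|\det A| = 1 -> Num.sqrt `|\det (a ^+ 2 *: A)| = a ^+ n.
Proof.
move=> a0 detA; rewrite detZ normrM detA mulr1 exprAC normrX sqrtr_sqr normr_id.
by rewrite ger0_norm// exprn_ge0.
Qed.

Section ConformallyFlat.
Context {R : realType} {n : nat}.
Variables (e : 'I_n -> R) (v : 'rV[R]_n -> R).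
Hypothesis e2 : forall a, e a * e a = 1.
Hypothesis v_gt0 : forall y, 0 < v y.
Hypothesis v_smooth : smooth_on setT v.

Let D : 'M[R]_n := diag_mx (\row_a e a).
Let h (y : 'rV[R]_n) : 'M[R]_n := v y ^+ 2 *: D.

Lemma diag_signs_mul : D *m D = 1%:M.
Proof.
rewrite /D mulmx_diag -scalemx1 -diag_const_mx scale1r; congr diag_mx.
by apply/rowP => i; rewrite !mxE e2.
Qed.

Lemma diag_signs_unit : D \in unitmx.
Proof. by have /mulmx1_unit[] := diag_signs_mul. Qed.

Lemma invmx_diag_signs : invmx D = D.
Proof. by rewrite -[LHS]mulmx1 -diag_signs_mul mulmxA mulVmx ?mul1mx ?diag_signs_unit. Qed.

Lemma invmx_scale_signs (a : R) : a != 0 -> invmx (a *: D) = a^-1 *: D.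
Proof.
move=> a0; rewrite invmxZ ?invmx_diag_signs//.
by rewrite unitmxZ ?unitfE// diag_signs_unit.
Qed.

Lemma metric_of_conformal y : metric_of h y = (v y)^-1 ^+ 2 *: D.
Proof. by rewrite /metric_of invmx_scale_signs ?exprVn// expf_neq0// gt_eqF. Qed.

Lemma diag_signsE i j : D i j = (i == j)%:R * e i.
Proof. by rewrite /D !mxE mulr_natl. Qed.

Lemma is_derive_v y w : is_derive y w v ('D_w v y).
Proof. by apply/derivableP/diff_derivable; have [+ _] := v_smooth 1; apply. Qed.

Lemma is_derive_Dv y w u : is_derive y w ('D_u v) ('D_w ('D_u v) y).
Proof.
by apply/derivableP/diff_derivable; have [_ /(_ u)[+ _]] := v_smooth 2; apply.
Qed.

Lemma is_derive_vV y w :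
  is_derive y w (fun z => (v z)^-1) (- ('D_w v y / v y ^+ 2)).
Proof.
have dv := is_derive_v y w; have v0 : v y != 0 by rewrite gt_eqF.
apply: DeriveDef; first exact: derivableV.
by rewrite deriveV// scaleNr [_ *: _]mulrC.
Qed.

Definition log_grad (b : 'I_n) (y : 'rV[R]_n) : R := - (partial b v y / v y).

(** The second derivative of [- ln v], expanded so that the part quadratic in the gradient is
    visible. *)
Definition log_hess (d b : 'I_n) (y : 'rV[R]_n) : R :=
  log_grad b y * log_grad d y - partial d (partial b v) y / v y.

Lemma is_derive_log_grad d b y :
  is_derive y (delta_mx 0 d) (log_grad b) (log_hess d b y).
Proof.
have v0 : v y != 0 by rewrite gt_eqF.
have dl := is_deriveN (is_deriveM (is_derive_Dv y (delta_mx 0 d) (delta_mx 0 b))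
  (is_derive_vV y (delta_mx 0 d))).
apply: (@is_derive_eq _ _ _ (log_grad b) _ _ _ _ dl); rewrite /log_hess /log_grad /partial /GRing.scale/=.
by field.
Qed.

Lemma partial_metric_conformal b d c y :
  partial b (fun z => metric_of h z d c) y =
  (d == c)%:R * e d * (2 * (v y)^-1 ^+ 2 * log_grad b y).
Proof.
have v0 : v y != 0 by rewrite gt_eqF.
have vV := is_derive_vV y (delta_mx 0 b).
have := is_deriveZ ((d == c)%:R * e d) (is_deriveM vV vV).
rewrite /partial (_ : (fun z => _) = ((d == c)%:R * e d) \*: ((fun z => (v z)^-1) * (fun z => (v z)^-1))); last first.
  by apply/funext => z; rewrite metric_of_conformal mxE diag_signsE mulrC.
move=> H; rewrite (derive_val (is_derive:=H)) /log_grad /partial /GRing.scale/=.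
by field.
Qed.

(** Since [h] is diagonal only [d = a] survives in the sum, and the factor [v^2] of [h] cancels the
    [v^-2] of the differentiated metric. *)
Lemma christoffel_conformal a b c y :
  christoffel h a b c y = conformal_christoffel e (log_grad^~ y) a b c.
Proof.
have v0 : v y != 0 by rewrite gt_eqF.
rewrite /christoffel (bigD1 a)//= big1 ?addr0; last first.
  by move=> d /negbTE da; rewrite /h mxE diag_signsE eq_sym da mul0r mulr0 mul0r.
rewrite !partial_metric_conformal /h mxE diag_signsE eqxx mul1r /conformal_christoffel.
have -> : (b == a)%:R * e b = (a == b)%:R * e a.
  by rewrite eq_sym; case: eqP => [->|]; rewrite ?mul0r.
transitivity ((e a * e a) * ((a == c)%:R * log_grad b y + (a == b)%:R * log_grad c y)
    - e a * e b * (b == c)%:R * log_grad a y); last by rewrite e2 mul1r.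
move: (log_grad a y) (log_grad b y) (log_grad c y) => la lb lc.
move: (a == c)%:R (a == b)%:R (b == c)%:R (e a) (e b) (v y) v0 => kac kab kbc ea eb vy v0; by field.
Qed.

(** The Christoffel symbols are linear in the gradient of [- ln v] with constant coefficients, so
    differentiating them replaces the gradient by a row of the Hessian. *)
Lemma partial_christoffel_conformal d a b c y :
  partial d (christoffel h a b c) y =
  conformal_christoffel e (fun k => log_hess d k y) a b c.
Proof.
have L k := is_derive_log_grad d k y.
have := is_deriveB (is_deriveD (is_deriveZ (a == c)%:R (L b))
  (is_deriveZ (a == b)%:R (L c))) (is_deriveZ (e a * e b * (b == c)%:R) (L a)).
rewrite /partial (_ : christoffel h a b c = (a == c)%:R \*: log_grad b
  + (a == b)%:R \*: log_grad c - (e a * e b * (b == c)%:R) \*: log_grad a).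
  by move=> H; rewrite (derive_val (is_derive:=H)).
by apply/funext => z; rewrite christoffel_conformal.
Qed.

(** The derivative terms give [(2 - n)] times the Hessian of [- ln v]. Its part [l_b l_d] cancels
    against the quadratic terms, leaving only the second derivative of [v]. *)
Lemma ricci_conformal b d y : b != d ->
  partial b (partial d v) y = partial d (partial b v) y ->
  ricci h y b d = (n%:R - 2) * (partial b (partial d v) y / v y).
Proof.
move=> bd vbd; rewrite mxE /riemann.
pose G := conformal_christoffel e (log_grad^~ y).
have E a : partial a (christoffel h a d b) y - partial d (christoffel h a a b) y
    + \sum_c christoffel h a a c y * christoffel h c d b y
    - \sum_c christoffel h a d c y * christoffel h c a b y =
  ((a == b)%:R * log_hess a d y + (a == d)%:R * log_hess a b y)
  - conformal_christoffel e (fun k => log_hess d k y) a a b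
  + (\sum_c G a a c * G c d b - \sum_c G a d c * G c a b).
  rewrite !partial_christoffel_conformal addrA; congr (_ - _ + _ - _).
  - exact: conformal_christoffel_neq.
  - by apply: eq_bigr => c _; rewrite !christoffel_conformal.
  - by apply: eq_bigr => c _; rewrite !christoffel_conformal.
transitivity (\sum_a ((a == b)%:R * log_hess a d y + (a == d)%:R * log_hess a b y)
  - \sum_a conformal_christoffel e (fun k => log_hess d k y) a a b
  + \sum_a (\sum_c G a a c * G c d b - \sum_c G a d c * G c a b)).
  by rewrite -sumrB -big_split; apply: eq_bigr => a _; exact: E.
transitivity (log_hess b d y + log_hess d b y - n%:R * log_hess d b y
  + (n%:R - 2) * (log_grad b y * log_grad d y)).
  congr (_ - _ + _).
  - exact: (sum_delta2 b d (fun a => log_hess a d y) (fun a => log_hess a b y)).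
  - exact: (sum_conformal_christoffel (fun k => log_hess d k y) e2 b).
  - exact: (conformal_ricci_quadratic (log_grad^~ y) e2 bd).
rewrite /log_hess vbd.
move: (log_grad b y) (log_grad d y) (partial _ _ _) (v y) => lb ld w vy.
by ring.
Qed.

(** Off the diagonal the term with the Ricci scalar drops out, as the metric is diagonal; the volume
    density contributes [v^-n]. *)
Lemma tf_einstein_density_conformal b d y : b != d ->
  partial b (partial d v) y = partial d (partial b v) y ->
  tf_einstein_density h y b d =
  (v y)^-1 ^+ n.+1 * ((n%:R - 2) * partial b (partial d v) y).
Proof.
move=> bd vbd; rewrite /tf_einstein_density metric_of_conformal.
have detD : `|\det D| = 1.
  have : \det D ^+ 2 = 1 by rewrite expr2 -det_mulmx diag_signs_mul det1.
  by move=> /eqP; rewrite sqrf_eq1 => /orP[] /eqP ->; rewrite ?normrN normr1.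
have vi : 0 <= (v y)^-1 by rewrite invr_ge0; exact/ltW/v_gt0.
rewrite (sqrt_norm_detZ vi detD).
have Rbd := ricci_conformal bd vbd.
have gbd : ((v y)^-1 ^+ 2 *: D) b d = 0.
  by rewrite mxE diag_signsE (negbTE bd) mul0r mulr0.
move: (ricci h y) (ricci_scalar h y) (_ *: D) Rbd gbd => Ric S g Rbd gbd.
rewrite !mxE Rbd gbd mulr0 subr0 exprSr.
move: (v y)^-1 (partial _ _ _) => w z; ring.
Qed.

End ConformallyFlat.

(** The contraction of the metric with its inverse is [n], which cancels the factor [1/n] of the
    subtracted trace. *)
Lemma tf_einstein_density_trace (R : realType) n (h : 'rV[R]_n -> 'M[R]_n) y :
  (0 < n)%N -> h y \in unitmx -> (h y)^T = h y ->
  \sum_i \sum_j tf_einstein_density h y i j * h y i j = 0.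
Proof.
move=> n0 hu hs; set s := Num.sqrt `|\det (metric_of h y)|.
have n0' : n%:R != 0 :> R by rewrite pnatr_eq0 -lt0n.
transitivity (s * (\sum_i \sum_j h y i j * ricci h y i j -
    n%:R^-1 * ricci_scalar h y * \sum_i \sum_j metric_of h y i j * h y i j)).
  rewrite mulr_sumr -sumrB mulr_sumr; apply: eq_bigr => i _.
  rewrite mulr_sumr -sumrB mulr_sumr; apply: eq_bigr => j _.
  by rewrite /tf_einstein_density !mxE -/s -/(ricci h y); ring.
have -> : \sum_i \sum_j metric_of h y i j * h y i j = n%:R.
  transitivity (\tr (metric_of h y *m (h y)^T)).
    by apply: eq_bigr => i _; rewrite mxE; apply: eq_bigr => j _; rewrite mxE.
  by rewrite hs mulVmx// mxtrace1.
by rewrite -/(ricci_scalar h y) mulrAC mulVf// mul1r subrr mulr0.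
Qed.

(** * Signature of perturbed flat metrics *)

Section Signature.
Context {R : realType} {n : nat}.
Variables (p q : nat) (i j : 'I_n).
Hypotheses (pqn : (p + q)%N = n) (ij : i != j).

Definition signs (a : 'I_n) : R := if (a < p)%N then 1 else -1.

Lemma signs2 a : signs a * signs a = 1.
Proof. by rewrite /signs; case: ifP => _; rewrite ?mulrNN mulr1. Qed.

(** All inverse metrics and variations of the argument have this shape at each point: a multiple of
    the flat inverse metric plus a symmetric off-diagonal entry. The shape is stable under sums and
    multiples, so two scalar functions describe a field. *)
Definition two_plane (al ta : R) : 'M[R]_n :=
  al *: diag_mx (\row_a signs a) + ta *: (delta_mx i j + delta_mx j i).

Lemma two_planeE al ta a b : two_plane al ta a b =
  al * ((a == b)%:R * signs a) + ta * (((a == i) && (b == j))%:R + ((a == j) && (b == i))%:R).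
Proof. by rewrite /two_plane !mxE mulr_natl. Qed.

Lemma tr_two_plane al ta : (two_plane al ta)^T = two_plane al ta.
Proof.
apply/matrixP => a b; rewrite mxE !two_planeE; congr (_ * _ + _ * _).
  by rewrite eq_sym; case: eqP => [->//|]; rewrite !mul0r.
by rewrite [LHS]addrC; congr (_%:R + _%:R); rewrite andbC.
Qed.

Lemma two_planeD al ta al' ta' :
  two_plane al ta + two_plane al' ta' = two_plane (al + al') (ta + ta').
Proof. by rewrite /two_plane addrACA !scalerDl. Qed.

Lemma two_planeZ c al ta : c *: two_plane al ta = two_plane (c * al) (c * ta).
Proof. by rewrite /two_plane scalerDr !scalerA. Qed.

Lemma two_plane_neq0 al ta : al != 0 -> two_plane al ta != 0.
Proof.
move=> al0; apply/eqP => /matrixP/(_ i i); rewrite two_planeE mxE eqxx (negbTE ij).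
rewrite andbF addr0 mulr0 addr0 mul1r => /eqP; rewrite mulf_eq0 (negbTE al0)/=.
by move=> /eqP si; have := signs2 i; rewrite si mul0r => /esym/eqP; rewrite oner_eq0.
Qed.

(** Completing the square in the plane of [i] and [j]: a shear [N] removes the off-diagonal entry
    and a diagonal scaling [S] normalises what is left. The bound on [ta] keeps the corrected [j]-th
    entry of the same sign as [signs j]. *)
Lemma two_plane_factor al ta : `|ta| < al -> exists2 Q : 'M[R]_n, Q \in unitmx &
  two_plane al ta = Q^T *m diag_mx (\row_a signs a) *m Q.
Proof.
move=> taal; have al0 : 0 < al by apply: le_lt_trans taal; exact: normr_ge0.
have c0 : 0 < al - signs i * signs j * ta ^+ 2 / al.
  rewrite subr_gt0 ltr_pdivrMr//.
  apply: (@le_lt_trans _ _ (`|ta| ^+ 2)).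
    apply: (le_trans (ler_norm _)); rewrite normrM normrX ler_piMl ?sqr_ge0//.
    by rewrite /signs; do 2 case: ifP => _; rewrite ?mulrN ?mulNr mulr1 ?opprK ?normrN normr1.
  by rewrite -expr2 ltrXn2r// nnegrE ltW.
(* The new [j]-th diagonal entry is the Schur complement [al * signs j - signs i * ta^2 / al], that
   is, [signs j] times the positive quantity [c0]. *)
pose s a : R := Num.sqrt (if a == j then al - signs i * signs j * ta ^+ 2 / al else al).
have s2 a : s a * s a = if a == j then al - signs i * signs j * ta ^+ 2 / al else al.
  by rewrite -expr2 sqr_sqrtr//; case: ifP => _; exact: ltW.
have s0 a : s a != 0.
  by rewrite gt_eqF// sqrtr_gt0; case: ifP => _.
(* The shear coefficient is [ta] divided by the [i]-th diagonal entry [al * signs i]. *)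
pose r := signs i * ta / al.
pose S : 'M[R]_n := diag_mx (\row_a s a).
pose N : 'M[R]_n := 1%:M + r *: delta_mx i j.
have Su : S \in unitmx.
  have : S *m diag_mx (\row_a (s a)^-1) = 1%:M.
    rewrite mulmx_diag -scalemx1 -diag_const_mx scale1r; congr diag_mx.
    by apply/rowP => a; rewrite !mxE mulfV.
  by move=> /mulmx1_unit[].
have Nu : N \in unitmx.
  have : N *m (1%:M - r *: delta_mx i j) = 1%:M.
    rewrite mulmxDl mul1mx mulmxBr mulmx1 -scalemxAl -scalemxAr mul_delta_mx_0 1?eq_sym//.
    by rewrite !scaler0 subr0 subrK.
  by move=> /mulmx1_unit[].
exists (S *m N); first by rewrite unitmx_mul Su Nu.
pose L a := s a * s a * signs a.
have SDS : S^T *m diag_mx (\row_a signs a) *m S = diag_mx (\row_a L a).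
  rewrite /S tr_diag_mx !mulmx_diag; congr diag_mx; apply/rowP => a; rewrite !mxE.
  by rewrite /L mulrAC.
rewrite trmx_mul -!mulmxA (mulmxA S^T) (mulmxA (S^T *m _)) SDS.
have Lr a : a != j -> L a = al * signs a by move=> aj; rewrite /L s2 (negbTE aj).
have rL : r * L i = ta.
  by rewrite Lr// /r; transitivity ((signs i * signs i) * ta); [field; rewrite gt_eqF|rewrite signs2 mul1r].
pose La : 'M[R]_n := diag_mx (\row_a L a).
have LE : La *m delta_mx i j = L i *: delta_mx i j.
  apply/matrixP => a b; rewrite mul_diag_mx !mxE.
  by case: eqP => [->//|_]; rewrite !mulr0.
have EL : delta_mx j i *m La = L i *: delta_mx j i.
  apply/matrixP => a b; rewrite mul_mx_diag !mxE mulrC.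
  by case: (b =P i) => [->//|_]; rewrite andbF !mulr0.
have -> : N^T *m (La *m N) = La + ta *: (delta_mx i j + delta_mx j i) + (r * ta) *: delta_mx j j.
  have -> : N^T = 1%:M + r *: delta_mx j i by rewrite /N linearD linearZ/= trmx1 trmx_delta.
  have -> : La *m N = La + ta *: delta_mx i j.
    by rewrite /N mulmxDr mulmx1 -scalemxAr LE scalerA rL.
  rewrite mulmxDl mul1mx -scalemxAl mulmxDr EL -scalemxAr mul_delta_mx.
  by rewrite !scalerDr !scalerA rL !addrA.
have Lj : L j = al * signs j - r * ta.
  rewrite /L s2 eqxx /r; transitivity (al * signs j - (signs j * signs j) * (signs i * ta / al * ta)).
    by field; rewrite gt_eqF.
  by rewrite signs2 mul1r.
apply/matrixP => a b; rewrite two_planeE !mxE mulr_natl.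
have [<-|ab] := eqVneq a b; last first.
  rewrite !mulr0n mulr0 !add0r.
  suff -> : ((a == j) && (b == j)) = false by rewrite mulr0 addr0.
  by apply/negP => /andP[/eqP aj /eqP bj]; rewrite aj bj eqxx in ab.
rewrite !mulr1n andbb; have [aj|aj] := eqVneq a j.
  by rewrite aj Lj eq_sym (negbTE ij) /=; ring.
by rewrite Lr// !mulr0n !mulr0 !addr0.
Qed.

Lemma two_plane_unit al ta : `|ta| < al -> two_plane al ta \in unitmx.
Proof.
move=> /two_plane_factor[Q Qu ->].
by rewrite !unitmx_mul unitmx_tr Qu (diag_signs_unit signs2).
Qed.

(** The sign matrix is its own inverse, so inverting the factorisation shows that [Q^T] diagonalises
    the metric itself. *)
Lemma has_signature_two_plane al ta : `|ta| < al ->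
  has_signature p q (invmx (two_plane al ta)).
Proof.
move=> taal; have [Q Qu QE] := two_plane_factor taal; split => //.
  by rewrite trmx_inv tr_two_plane.
exists Q^T; first by rewrite unitmx_tr.
pose D : 'M[R]_n := diag_mx (\row_a signs a); pose G := invmx (two_plane al ta).
rewrite trmxK -/G -/D.
have : (G *m Q^T *m D) *m Q = 1%:M.
  by rewrite -!mulmxA [Q^T *m _]mulmxA -QE mulVmx// two_plane_unit.
move=> /mulmx1C; rewrite !mulmxA => GD.
by rewrite -[LHS]mulmx1 -(diag_signs_mul signs2) mulmxA GD mul1mx.
Qed.

End Signature.

(** * Tensor fields on a chart domain *)

Section Jacobian.
Context {R : realType} {n m k : nat}.

Lemma jacobian_comp (f : 'rV[R]_n -> 'rV[R]_m) (g : 'rV[R]_m -> 'rV[R]_k) x :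
  differentiable f x -> differentiable g (f x) ->
  jacobian (g \o f) x = jacobian f x *m jacobian g (f x).
Proof.
move=> df dg; apply/row_matrixP => i.
by rewrite !rowE mulmxA /jacobian !mul_rV_lin1 diff_comp.
Qed.

Lemma near_eq_jacobian (f g : 'rV[R]_n -> 'rV[R]_m) x :
  (\near x, f x = g x) -> differentiable f x -> jacobian f x = jacobian g x.
Proof.
move=> fg df; have dg := near_eq_differentiable fg df.
apply/row_matrixP => i; rewrite [LHS]rowE [RHS]rowE.
have Ef := deriveEjacobian (delta_mx 0 i) df.
have Eg := deriveEjacobian (delta_mx 0 i) dg.
exact: etrans (esym Ef) (etrans (near_eq_derive _ fg) Eg).
Qed.

Lemma jacobianE (f : 'rV[R]_n -> 'rV[R]_m) x i j : differentiable f x ->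
  jacobian f x i j = 'D_(delta_mx 0 i) f x 0 j.
Proof. by move=> df; rewrite (deriveEjacobian _ df) -rowE [RHS]mxE. Qed.

End Jacobian.

Section ChartField.
Context {R : realType} {n : nat} (M : smooth_manifold R n).
Implicit Types (c : atlas M) (x : M) (y : 'rV[R]_n).

Lemma chart_image_open c (W : set M) : open W -> open (chart c @` (W `&` dom c)).
Proof.
move=> oW.
have -> : chart c @` (W `&` dom c) =
    chart c @` dom c `&` (chart_inv c @^-1` W).
  apply/seteqP; split=> [_ [x [Wx cx] <-]|y [[x cx <-]]] /=.
    by split; [exists x|rewrite chartK].
  by rewrite chartK// => Wx; exists x.
rewrite openE => y [cy Wy]; rewrite /interior /=.
have cV := chart_inv_continuous cy.
apply: filterI; first by apply: open_nbhs_nbhs; split => //; exact: chart_open.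
exact/cV/open_nbhs_nbhs.
Qed.

Lemma chart_overlap_open c c' : open (chart c @` (dom c `&` dom c')).
Proof. by rewrite setIC; apply: chart_image_open; exact: dom_open. Qed.

Lemma transition_differentiable c c' x : dom c x -> dom c' x ->
  differentiable (chart c' \o chart_inv c) (chart c x).
Proof.
by move=> cx c'x; have [+ _] := transition_smooth c c' 1; apply; exists x.
Qed.

(** The chain rule for transition maps; the composite agrees with the direct transition only near
    [chart c x], which suffices for the Jacobians. *)
Lemma jacobian_cocycle c c' c'' x : dom c x -> dom c' x -> dom c'' x ->
  jacobian_at c c'' x = jacobian_at c' c'' x *m jacobian_at c c' x.
Proof.
move=> cx c'x c''x; rewrite /jacobian_at -trmx_mul; congr trmx.
have d1 := transition_differentiable cx c'x.
have d2 := transition_differentiable c'x c''x.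
have f1 : (chart c' \o chart_inv c) (chart c x) = chart c' x by rewrite /= (chartK cx).
have d2' := d2; rewrite -f1 in d2'.
have nE : \forall y \near chart c x, ((chart c'' \o chart_inv c') \o (chart c' \o chart_inv c)) y =
    (chart c'' \o chart_inv c) y.
  have : \forall y \near chart c x, (chart c @` (dom c `&` dom c')) y.
    by apply: open_nbhs_nbhs; split; [exact: chart_overlap_open|exists x].
  by apply: filterS => _ [z [cz c'z] <-] /=; rewrite (chartK cz) chartK.
have E1 := near_eq_jacobian nE (differentiable_comp d1 d2').
have E2 := jacobian_comp d1 d2'; rewrite f1 in E2.
exact: etrans (esym E1) E2.
Qed.

Lemma jacobian_at_id c x : dom c x -> jacobian_at c c x = 1%:M.
Proof.
move=> cx; rewrite /jacobian_at (_ : jacobian _ _ = 1%:M) ?trmx1//.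
have nid : \forall y \near chart c x, (chart c \o chart_inv c) y = id y.
  have : \forall y \near chart c x, (chart c @` (dom c `&` dom c)) y.
    by apply: open_nbhs_nbhs; split; [exact: chart_overlap_open|exists x].
  by apply: filterS => _ [z [cz _] <-] /=; rewrite (chartK cz).
rewrite (near_eq_jacobian nid); last exact: transition_differentiable.
have did : differentiable (@id 'rV[R]_n) (chart c x) by [].
apply/row_matrixP => i; rewrite [LHS]rowE [RHS]rowE mulmx1.
have Eid := deriveEjacobian (delta_mx 0 i) did.
exact: etrans (esym Eid) (derive_id _ _).
Qed.

Lemma jacobian_at_unit c c' x : dom c x -> dom c' x -> jacobian_at c c' x \in unitmx.
Proof.
move=> cx c'x; have := jacobian_at_id cx; rewrite (jacobian_cocycle cx c'x cx).
by move=> /mulmx1_unit[].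
Qed.

Lemma jacobian_at_smooth c c' k i j :
  Ck_on k (chart c @` (dom c `&` dom c'))
    (fun y => jacobian_at c c' (chart_inv c y) i j).
Proof.
have oV := @chart_overlap_open c c'.
have [dt /(_ (delta_mx 0 j))/(Ck_on_mxP _ _ oV)/(_ 0 i)] := transition_smooth c c' k.+1.
apply: Ck_on_ext => // y Vy; have dty := dt y Vy; case: Vy => x [cx c'x] xy.
by rewrite /jacobian_at mxE -xy chartK// xy jacobianE.
Qed.

Variable c0 : atlas M.

(* The case distinction makes the component in c0 equal to H as a function, and
   not only on the range of the chart. *)
Definition chart_field (H : 'rV[R]_n -> 'M[R]_n) : field M := fun c y =>
  if pselect (c = c0) is left _ then H y else
  jacobian_at c0 c (chart_inv c y) *m H (chart c0 (chart_inv c y)) *m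
    (jacobian_at c0 c (chart_inv c y))^T.

Lemma chart_field_chart H : chart_field H c0 = H.
Proof. by apply/funext => y; rewrite /chart_field; case: pselect. Qed.

Lemma chart_fieldE H c x : dom c0 x -> dom c x -> chart_field H c (chart c x) =
  jacobian_at c0 c x *m H (chart c0 x) *m (jacobian_at c0 c x)^T.
Proof.
move=> c0x cx; rewrite /chart_field; case: pselect => [cc0|_]; last by rewrite chartK.
by subst c; rewrite jacobian_at_id// mul1mx trmx1 mulmx1.
Qed.

Lemma chart_field_smooth H c : smooth_on setT H ->
  smooth_on (chart c @` (dom c0 `&` dom c)) (chart_field H c).
Proof.
move=> sH k; rewrite setIC; set V := chart c @` _.
have oV : open V by exact: chart_overlap_open.
pose J y := jacobian_at c0 c (chart_inv c y).
pose T y := chart c0 (chart_inv c y).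
have CT : Ck_on k V T by exact: transition_smooth.
have oV0 : open (chart c0 @` (dom c0 `&` dom c)) by exact: chart_overlap_open.
have TV y : V y -> (chart c0 @` (dom c0 `&` dom c)) (T y).
  by move=> [x [cx c0x] <-]; exists x => //; rewrite /T chartK.
(* The Jacobian is known to be smooth in the coordinates of [c0], so it is precomposed with the
   transition [T] from [c] to [c0]. *)
have CJ i j : Ck_on k V (fun y => J y i j).
  have C := Ck_on_comp oV oV0 TV CT (@jacobian_at_smooth c0 c k i j).
  apply: (Ck_on_ext oV _ C) => _ [x [cx c0x] <-].
  by rewrite /J /T /= (chartK cx) (chartK c0x).
have CH i j : Ck_on k V (fun y => H (T y) i j).
  have CHij := (Ck_on_mxP k H (@openT _)).1 (sH k) i j.
  exact: (Ck_on_comp oV (@openT _) (fun _ _ => I) CT CHij).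
apply/(Ck_on_mxP _ _ oV) => i j.
have C : Ck_on k V (fun y => \sum_b (\sum_a J y i a * H (T y) a b) * J y j b).
  by apply: Ck_on_sum => // b _; apply: Ck_onM => //; apply: Ck_on_sum => // a _; apply: Ck_onM.
apply: (Ck_on_ext oV _ C) => _ [x [cx c0x] <-].
rewrite (chart_fieldE _ c0x cx) /J /T (chartK cx) mxE; apply: eq_bigr => b _.
by rewrite !mxE; congr (_ * _); rewrite mxE.
Qed.

Lemma chart_field_tensor H : smooth_on setT H -> (forall y, (H y)^T = H y) ->
  sym_contra_tensor (dom c0) (chart_field H).
Proof.
move=> sH symH; split=> [c|c x c0x cx|c c' x c0x cx c'x].
- exact: chart_field_smooth.
- by rewrite (chart_fieldE _ c0x cx) !trmx_mul trmxK symH mulmxA.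
- rewrite (chart_fieldE _ c0x cx) (chart_fieldE _ c0x c'x) (jacobian_cocycle c0x cx c'x).
  by rewrite trmx_mul !mulmxA.
Qed.

(** The covariant transformation law of the metric, deduced from the contravariant law of its
    inverse; it transports a diagonalising frame from one chart to another. *)
Lemma invmx_congruence (J H : 'M[R]_n) : J \in unitmx -> H \in unitmx ->
  J^T *m invmx (J *m H *m J^T) *m J = invmx H.
Proof.
move=> Ju Hu; set A := J *m H *m J^T.
have Au : A \in unitmx by rewrite !unitmx_mul Ju Hu unitmx_tr.
have : (J^T *m invmx A *m J) *m H = 1%:M.
  (* Two cyclic rotations of the product bring it to [A *m invmx A]. *)
  apply: mulmx1C; rewrite !mulmxA; apply: mulmx1C; rewrite !mulmxA.
  by rewrite mulmxV.
by move=> E; rewrite -[LHS]mulmx1 -(mulmxV Hu) mulmxA E mul1mx.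
Qed.

Lemma chart_field_inverse_metric p q H : smooth_on setT H ->
  (forall y, (H y)^T = H y) -> (forall y, H y \in unitmx) ->
  (forall y, has_signature p q (invmx (H y))) ->
  inverse_metric p q (dom c0) (chart_field H).
Proof.
move=> sH symH Hu Hpq; split=> [|c x c0x cx]; first exact: chart_field_tensor.
have [pqn _ [P Pu PE]] := Hpq (chart c0 x); have Ju := jacobian_at_unit c0x cx.
rewrite /metric_of (chart_fieldE _ c0x cx); split => //.
  by rewrite trmx_inv !trmx_mul trmxK symH mulmxA.
exists (jacobian_at c0 c x *m P); first by rewrite unitmx_mul Ju.
rewrite trmx_mul -[RHS]PE -(invmx_congruence Ju (Hu _)) !mulmxA.
by [].
Qed.

Lemma chart_field_support H :
  tensor_support (dom c0) (chart_field H) =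
  closure [set x | dom c0 x /\ H (chart c0 x) != 0].
Proof.
congr closure; apply/seteqP; split=> x /= [c0x].
  move=> [c cx]; rewrite (chart_fieldE _ c0x cx) => nz; split=> //.
  by apply: contra_neq nz => ->; rewrite mulmx0 mul0mx.
by move=> nz; split=> //; exists c0 => //; rewrite chart_field_chart.
Qed.

(** The preimage of [K] in the manifold is compact, hence closed as the manifold is Hausdorff. It
    therefore contains the closure taken in the whole of [M], which cannot leave the chart
    domain. *)
Lemma support_compact (K : set 'rV[R]_n) (P : set 'rV[R]_n) : compact K ->
  K `<=` chart c0 @` dom c0 -> P `<=` K ->
  let S := closure [set x | dom c0 x /\ P (chart c0 x)] in
  compact S /\ S `<=` dom c0.
Proof.
move=> cK KV PK S.
have cL : compact (chart_inv c0 @` K).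
  apply: continuous_compact => //; apply: continuous_in_subspaceT => y.
  rewrite inE => Ky; exact/chart_inv_continuous/KV.
have SL : S `<=` chart_inv c0 @` K.
  have /closure_id -> := compact_closed (@carrier_hausdorff _ _ M) cL.
  apply: closure_subset => x [c0x Px]; exists (chart c0 x); first exact: PK.
  exact: chartK.
split; first by apply: subclosed_compact cL SL; exact: closed_closure.
by move=> x /SL[y Ky <-]; have [z c0z <-] := KV y Ky; rewrite chartK.
Qed.

End ChartField.

(** * Variation of the action *)

Lemma integral_rV0 (R : realType) n : integral_rV (fun _ : 'rV[R]_n => 0) = 0.
Proof.
elim: n => //= n ->; rewrite /Rintegral (_ : (fun _ => _) = cst 0%E) ?integral0//.
Qed.

Lemma continuous_compact_bounded (T : topologicalType) (R : realType) (K : set T)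
    (f : T -> R) : compact K -> continuous f ->
  exists2 C, 0 < C & forall x, K x -> `|f x| <= C.
Proof.
move=> cK cf; have cfK : compact (f @` K).
  by apply: continuous_compact => //; exact: continuous_subspaceT.
have [N [_ NP]] := @compact_bounded R R _ cfK.
exists (`|N| + 1) => [|x Kx]; first by rewrite ltr_wpDl.
apply: (NP (`|N| + 1)); last by exists x.
by rewrite (le_lt_trans (ler_norm N))// ltrDl.
Qed.

Lemma is_derive0_segment_eq (R : realType) (f : R -> R) :
  (forall s : R, 0 <= s <= 1 -> is_derive s 1 f 0) -> f 1 = f 0.
Proof.
move=> df; apply/eqP; rewrite -subr_eq0; apply/eqP.
have dfo (s : R) : s \in `]0, 1[%R -> is_derive s 1 f (cst 0 s).
  by rewrite in_itv/= => /andP[/ltW s0 /ltW s1]; apply: df; rewrite s0.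
have [] := MVT_segment ler01 dfo; last by move=> x _ ->; rewrite mul0r.
apply: derivable_within_continuous => s; rewrite in_itv/= => s01.
by have [] := df s s01.
Qed.

Section TwoPlane.
Context {R : realType} {n : nat}.
Variables (p : nat) (i j : 'I_n).
Hypothesis ij : i != j.

Lemma two_plane_smooth (al ta : 'rV[R]_n -> R) :
  smooth_on setT al -> smooth_on setT ta ->
  smooth_on setT (fun y => two_plane p i j (al y) (ta y)).
Proof.
move=> sal sta k; have oT := @openT 'rV[R]_n; apply/(Ck_on_mxP _ _ oT) => a b.
have Ca := Ck_onM oT (sal k) (@Ck_on_cst R _ R k setT ((a == b)%:R * signs p a)).
have Ct := Ck_onM oT (sta k) (@Ck_on_cst R _ R k setT
  (((a == i) && (b == j))%:R + ((a == j) && (b == i))%:R)).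
by apply: (Ck_on_ext oT _ (Ck_onD oT Ca Ct)) => y _; rewrite two_planeE.
Qed.

(** A variation proportional at [y] to the inverse metric is an infinitesimal conformal rescaling
    there, and the trace-free density annihilates it. *)
Lemma tf_einstein_two_plane_trace (al ta be sg : 'rV[R]_n -> R) y c : (0 < n)%N ->
  `|ta y| < al y -> be y = c * al y -> sg y = c * ta y ->
  \sum_a \sum_b tf_einstein_density (fun z => two_plane p i j (al z) (ta z)) y a b
    * two_plane p i j (be y) (sg y) a b = 0.
Proof.
move=> n0 taal -> ->; rewrite -two_planeZ.
have T := tf_einstein_density_trace (h := fun z => two_plane p i j (al z) (ta z)) (y := y) n0
  (two_plane_unit p ij taal) (tr_two_plane _ _ _ _ _).
transitivity (c * 0); last by rewrite mulr0.
rewrite -[in RHS]T mulr_sumr; apply: eq_bigr => a _.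
rewrite mulr_sumr; apply: eq_bigr => b _.
rewrite [X in _ * X](_ : _ = c * two_plane p i j (al y) (ta y) a b); last by rewrite mxE.
exact: mulrCA.
Qed.

Lemma sum_mul_two_plane (E : 'M[R]_n) (al ta : R) :
  \sum_a \sum_b E a b * two_plane p i j al ta a b =
  \sum_a \sum_b E a b * two_plane p i j al 0 a b + ta * (E i j + E j i).
Proof.
have S k l : \sum_a \sum_b E a b * ((a == k) && (b == l))%:R = E k l.
  rewrite (bigD1 k)//= (bigD1 l)//= !eqxx mulr1 !big1 ?addr0//.
    by move=> a /negbTE ->; rewrite big1// => b _; rewrite mulr0.
  by move=> b /negbTE ->; rewrite mulr0.
rewrite -(S i j) -(S j i) -big_split mulr_sumr -big_split; apply: eq_bigr => a _.
rewrite -big_split mulr_sumr -big_split; apply: eq_bigr => b _ /=.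
by rewrite !two_planeE; ring.
Qed.

(** The diagonal part of the variation is a multiple of the inverse metric and contributes nothing;
    the entries [(i, j)] and [(j, i)] contribute equally, whence the factor 2. *)
Lemma tf_einstein_two_plane_conformal (v be sg : 'rV[R]_n -> R) y : (0 < n)%N ->
  smooth_on setT v -> (forall y, 0 < v y) ->
  partial i (partial j v) y = partial j (partial i v) y ->
  \sum_a \sum_b tf_einstein_density (fun z => two_plane p i j (v z ^+ 2) 0) y a b
    * two_plane p i j (be y) (sg y) a b =
  2 * (n%:R - 2) * (sg y * (v y)^-1 ^+ n.+1 * partial i (partial j v) y).
Proof.
move=> n0 sv v0 vij; rewrite sum_mul_two_plane.
set E := tf_einstein_density _ y.
have v2 : 0 < v y ^+ 2 by rewrite exprn_gt0.
have -> : \sum_a \sum_b E a b * two_plane p i j (be y) 0 a b = 0.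
  have h1 : `|0 : R| < v y ^+ 2 by rewrite normr0.
  have h2 := esym (divfK (lt0r_neq0 v2) (be y)).
  have h3 := esym (mulr0 (be y / v y ^+ 2)).
  exact: (@tf_einstein_two_plane_trace (fun z => v z ^+ 2) (fun=> 0) be (fun=> 0) y
    (be y / v y ^+ 2) n0 h1 h2 h3).
rewrite /E add0r.
rewrite (_ : (fun z => two_plane p i j (v z ^+ 2) 0) =
  fun z => v z ^+ 2 *: diag_mx (\row_a signs p a)); last first.
  by apply/funext => z; rewrite /two_plane scale0r addr0.
have ji : j != i by rewrite eq_sym.
rewrite (tf_einstein_density_conformal (@signs2 R n p) v0 sv ij vij).
rewrite (tf_einstein_density_conformal (@signs2 R n p) v0 sv ji (esym vij)) -vij.
move: (partial _ _ _) (_ ^-1 ^+ _) (sg y) => w z s; ring.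
Qed.

End TwoPlane.

Section Variation.
Context {R : realType} {n : nat} (M : smooth_manifold R n).
Variables (p q : nat) (i j : 'I_n).
Hypotheses (pqn : (p + q)%N = n) (ij : i != j).
Variables (k : nat) (L : lagrangian M k).
Hypothesis varL : variational_derivative p q L (@tf_einstein R n M).
Variables (c0 : atlas M) (psi : 'rV[R]_n -> R) (K : set 'rV[R]_n).
Hypotheses (cK : compact K) (KV : K `<=` chart c0 @` dom c0)
  (psiK : forall y, psi y != 0 -> K y).

Let S : set M := closure [set x | dom c0 x /\ psi (chart c0 x) != 0].
Let A : set 'rV[R]_n := chart c0 @` (S `&` dom c0).

(** The domain of integration depends on [psi] alone, so that the actions of different families of
    metrics can be compared. *)
Definition two_plane_action (al ta : 'rV[R]_n -> R) : R :=
  integral_rV (fun y => \1_A y *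
    L c0 (y, jet k (fun z => two_plane p i j (al z) (ta z)) y)).

Lemma mul_support_indicator (w : 'rV[R]_n -> R) :
  (forall y, psi y = 0 -> w y = 0) -> (fun y => \1_A y * w y) = w.
Proof.
move=> w0; apply/funext => y; have [py|py] := eqVneq (psi y) 0.
  by rewrite (w0 _ py) mulr0.
rewrite indicE mem_set ?mul1r//.
have [x c0x xy] := KV (psiK py); exists x => //; split=> //.
by apply: subset_closure; split=> //; rewrite xy.
Qed.

(** The variational hypothesis read in the single chart [c0]. The variation vanishes exactly where
    [psi] does, so its tensor support is [S], the set over which the action is integrated. *)
Lemma is_derive_two_plane_action (al ta be sg : 'rV[R]_n -> R) :
  smooth_on setT al -> smooth_on setT ta ->
  smooth_on setT be -> smooth_on setT sg ->
  (forall y, `|ta y| < al y) ->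
  (forall y, psi y != 0 -> be y != 0) ->
  (forall y, psi y = 0 -> be y = 0 /\ sg y = 0) ->
  is_derive (0 : R) 1
    (fun eps : R => two_plane_action (fun y => al y + eps * be y) (fun y => ta y + eps * sg y))
    (integral_rV (fun y => \sum_a \sum_b
       tf_einstein_density (fun z => two_plane p i j (al z) (ta z)) y a b
       * two_plane p i j (be y) (sg y) a b)).
Proof.
move=> sal sta sbe ssg taal psibe psi0.
pose H z := two_plane p i j (al z) (ta z).
pose B z := two_plane p i j (be z) (sg z).
have metH : inverse_metric p q (dom c0) (chart_field c0 H).
  apply: chart_field_inverse_metric => [|y|y|y].
  - exact: two_plane_smooth.
  - exact: tr_two_plane.
  - exact: two_plane_unit.
  - exact: has_signature_two_plane.
have tenB : sym_contra_tensor (dom c0) (chart_field c0 B).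
  apply: chart_field_tensor => [|y]; last exact: tr_two_plane.
  exact: two_plane_smooth.
have B0 y : psi y = 0 -> B y = 0.
  by move=> /psi0[b0 s0]; rewrite /B b0 s0 /two_plane !scale0r addr0.
have BS : tensor_support (dom c0) (chart_field c0 B) = S.
  rewrite chart_field_support /S; congr closure; apply/seteqP; split=> x /= [c0x nz].
    by split=> //; apply: contra_neq nz => /B0.
  by split=> //; exact/two_plane_neq0/psibe.
have [cS Sd] := support_compact (P := [set y | psi y != 0]) cK KV psiK.
have [_ /(_ _ _ (dom_open c0) metH)[_ var]] := varL.
have {var} := var _ tenB; rewrite BS => /(_ cS Sd [:: c0]).
have cov : charts_cover [:: c0] S by rewrite /= setD_eq0.
move=> /(_ cov) dS.
have E1 : (fun eps : R => density_integral [:: c0] S (lagrangian_at L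
    (fun c y => chart_field c0 H c y + eps *: chart_field c0 B c y))) =
    fun eps => two_plane_action (fun y => al y + eps * be y) (fun y => ta y + eps * sg y).
  apply/funext => eps; rewrite /= addr0 /two_plane_action; congr integral_rV.
  apply/funext => y; congr (_ * _); rewrite /lagrangian_at; congr (L c0 (y, jet k _ y)).
  by apply/funext => z; rewrite !chart_field_chart two_planeZ two_planeD.
have E2 : density_integral [:: c0] S (fun c y => \sum_a \sum_b
      tf_einstein (chart_field c0 H) c y a b * chart_field c0 B c y a b) =
    integral_rV (fun y => \sum_a \sum_b tf_einstein_density H y a b * B y a b).
  rewrite /= addr0 /tf_einstein !chart_field_chart mul_support_indicator// => y /B0 By.
  by rewrite big1// => a _; rewrite big1// => b _; rewrite By [X in _ * X]mxE mulr0.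
by rewrite -E1 -E2; exact: dS.
Qed.

(** The variational derivative is taken at parameter 0; this moves it to any point of a path of
    metrics. *)
Lemma is_derive_translate (f : R -> R) (s d : R) :
  is_derive (0 : R) 1 (fun e => f (s + e)) d -> is_derive s 1 f d.
Proof.
move=> df; have sh : is_derive s 1 (fun x => x - s) (1 : R).
  have := is_deriveB (is_derive_id s 1) (is_derive_cst s s 1).
  by rewrite subr0.
have df' : is_derive (s - s) 1 (fun e => f (s + e)) d by rewrite subrr.
have := @is_derive1_comp R (fun e => f (s + e)) (fun x => x - s) s _ _ df' sh.
rewrite mulr1 (_ : _ \o _ = f)//; apply/funext => x /=.
by rewrite addrC subrK.
Qed.

(* Along s |-> (1 + s chi) h the variation is pointwise a multiple of h, so
   that its contraction with the trace-free tensor vanishes. *)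
Lemma two_plane_action_conformal (al ta chi : 'rV[R]_n -> R) : (0 < n)%N ->
  smooth_on setT al -> smooth_on setT ta -> smooth_on setT chi ->
  (forall y, `|ta y| < al y) -> (forall y, 0 <= chi y) ->
  (forall y, (chi y == 0) = (psi y == 0)) ->
  two_plane_action (fun y => (1 + chi y) * al y) (fun y => (1 + chi y) * ta y) =
  two_plane_action al ta.
Proof.
move=> n0 sal sta schi taal chi0 chipsi.
pose f (s : R) := two_plane_action (fun y => (1 + s * chi y) * al y)
  (fun y => (1 + s * chi y) * ta y).
have -> : two_plane_action (fun y => (1 + chi y) * al y) (fun y => (1 + chi y) * ta y) = f 1.
  by congr two_plane_action; apply/funext => y; rewrite mul1r.
have -> : two_plane_action al ta = f 0.
  by congr two_plane_action; apply/funext => y; rewrite mul0r addr0 mul1r.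
(* At parameter [s] the base field is [(1 + s chi) h] and the direction is [chi h], which is
   [chi / (1 + s chi)] times the base field. *)
apply: is_derive0_segment_eq => s /andP[s0 _]; apply: is_derive_translate.
have oT := @openT 'rV[R]_n.
have om y : 0 < 1 + s * chi y by rewrite ltr_wpDr// mulr_ge0.
have som : smooth_on setT (fun y => 1 + s * chi y).
  move=> m; have Cs := @Ck_on_cst R 'rV[R]_n R m setT s.
  have C1 := @Ck_on_cst R 'rV[R]_n R m setT 1.
  exact: (Ck_onD oT C1 (Ck_onM oT Cs (schi m))).
have sM (g h : 'rV[R]_n -> R) : smooth_on setT g -> smooth_on setT h ->
  smooth_on setT (fun y => g y * h y) by move=> sg sh m; exact: Ck_onM.
have al0 y : 0 < al y by apply: le_lt_trans (taal y); exact: normr_ge0.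
have D := @is_derive_two_plane_action (fun y => (1 + s * chi y) * al y)
  (fun y => (1 + s * chi y) * ta y) (fun y => chi y * al y) (fun y => chi y * ta y)
  (sM _ _ som sal) (sM _ _ som sta) (sM _ _ schi sal) (sM _ _ schi sta).
have h1 y : `|(1 + s * chi y) * ta y| < (1 + s * chi y) * al y.
  by rewrite normrM (gtr0_norm (om y)) ltr_pM2l ?om ?taal.
have h2 y : psi y != 0 -> chi y * al y != 0.
  by rewrite -chipsi => ch; rewrite mulf_eq0 negb_or ch gt_eqF.
have h3 y : psi y = 0 -> chi y * al y = 0 /\ chi y * ta y = 0.
  by move=> /eqP; rewrite -chipsi => /eqP ->; rewrite !mul0r.
have {D} := D h1 h2 h3.
rewrite (_ : (fun y => \sum_a \sum_b _) = fun=> 0) ?integral_rV0; last first.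
  apply/funext => y; have o0 := lt0r_neq0 (om y).
  have h4 (a : R) : chi y * a = chi y / (1 + s * chi y) * ((1 + s * chi y) * a).
    by rewrite mulrA divfK.
  exact: (@tf_einstein_two_plane_trace R n p i j ij (fun y => (1 + s * chi y) * al y)
    (fun y => (1 + s * chi y) * ta y) (fun y => chi y * al y) (fun y => chi y * ta y) y
    (chi y / (1 + s * chi y)) n0 (h1 y) (h4 _) (h4 _)).
rewrite (_ : (fun eps => _) = fun e => f (s + e))//; apply/funext => e.
by congr two_plane_action; apply/funext => y; ring.
Qed.

End Variation.

(** * Contradiction from two conformally related families *)

Theorem theorem1 (R : realType) (n : nat) (hn : (3 <= n)%N)
    (p q : nat) (hpq : (p + q)%N = n)
    (M : smooth_manifold R n) (hM : [set: M] !=set0) :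
  ~ exists (k : nat) (L : lagrangian M k),
      local_lagrangian p q L /\ variational_derivative p q L (@tf_einstein R n M).
Proof.
move=> [k [L [_ varL]]]; have [x0 _] := hM; have [c0 c0x0] := dom_cover x0.
have n0 : (0 < n)%N by exact: leq_trans hn.
have n1 : (1 < n)%N by exact: leq_trans hn.
pose i := Ordinal n0; pose j := Ordinal n1; have ij : i != j by [].
have Vx0 : (chart c0 @` dom c0) (chart c0 x0) by exists x0.
have [psi [kappa [[spsi skappa] psi0 [pij pji] [K cK [KV psiK]] pos]]] :=
  separated_bump ij (@chart_open _ _ _ c0) Vx0.
(* The power of [v] in [w] balances the [v^2] of the rescaled variation against the [v^-(n+1)] of
   the density, so that the second derivative below integrates [psi * kappa^2] up to a constant. *)
pose v y := 1 + psi y; pose w y := v y ^+ n.-1 * kappa y; pose sg y := psi y * w y.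
have oT := @openT 'rV[R]_n.
have scst (a : R) : smooth_on setT (fun _ : 'rV[R]_n => a) by move=> m; exact: Ck_on_cst.
have sM (g h : 'rV[R]_n -> R) : smooth_on setT g -> smooth_on setT h ->
  smooth_on setT (fun y => g y * h y) by move=> sg' sh m; exact: Ck_onM.
have sD (g h : 'rV[R]_n -> R) : smooth_on setT g -> smooth_on setT h ->
  smooth_on setT (fun y => g y + h y) by move=> sg' sh m; exact: Ck_onD.
have sX (g : 'rV[R]_n -> R) l : smooth_on setT g -> smooth_on setT (fun y => g y ^+ l).
  by move=> sg' m; exact: Ck_onX.
have sv : smooth_on setT v := sD _ _ (scst 1) spsi.
have ssg : smooth_on setT sg := sM _ _ spsi (sM _ _ (sX _ _ sv) skappa).
have v0 y : 0 < v y by rewrite ltr_wpDr.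
have cont (g : 'rV[R]_n -> R) : smooth_on setT g -> continuous g.
  by move=> sg' y; exact: (sg' 0).
have [C1 C10 psiC] := continuous_compact_bounded cK (cont _ spsi).
have [C2 C20 sgC] := continuous_compact_bounded cK (cont _ ssg).
(* For such [t] the sum of [|t * sg y|] and [|t * psi y|] is below 1 on [K], and both vanish off
   [K]; hence the perturbed flat field stays an inverse metric of the same signature. *)
have bound t : `|t| < (C1 + C2)^-1 -> forall y, `|t * sg y| < 1 + t * psi y.
  rewrite -[_^-1]mul1r ltr_pdivlMr ?addr_gt0// mulrDr => tC y.
  have [py|/psiK Ky] := eqVneq (psi y) 0.
    by rewrite /sg py mul0r !mulr0 normr0 addr0.
  have b1 : `|t * sg y| <= `|t| * C2 by rewrite normrM ler_wpM2l// sgC.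
  have b2 : `|t * psi y| <= `|t| * C1 by rewrite normrM ler_wpM2l// psiC.
  have b3 := ler_norm (- (t * psi y)); rewrite normrN in b3.
  lra.
have pv a : partial a v = partial a psi.
  apply/funext => y; rewrite /partial (_ : v = cst 1 + psi)// deriveD//.
    by rewrite derive_cst add0r.
  by apply/diff_derivable; have [+ _] := spsi 1; apply.
have pvij y : partial i (partial j v) y = kappa y by rewrite pv pij.
have pvji y : partial j (partial i v) y = kappa y by rewrite pv pji.
pose act := two_plane_action p i j L c0 psi.
(* [D1] differentiates the action along the flat field plus [t] times the variation, [D2] along the
   same family multiplied by [v^2]. The flat coefficient is written [1 ^+ 2] to match the conformal
   formula with [v = 1]. *)
have D1 := @is_derive_two_plane_action R n M p q i j hpq ij k L varL c0 psi K cK KV psiK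
  (fun=> 1 ^+ 2) (fun=> 0) psi sg (scst _) (scst _) spsi ssg.
have D2 := @is_derive_two_plane_action R n M p q i j hpq ij k L varL c0 psi K cK KV psiK
  (fun y => v y ^+ 2) (fun=> 0) (fun y => v y ^+ 2 * psi y) (fun y => v y ^+ 2 * sg y)
  (sX _ _ sv) (scst _) (sM _ _ (sX _ _ sv) spsi) (sM _ _ (sX _ _ sv) ssg).
have v2 y : 0 < v y ^+ 2 by exact: exprn_gt0.
have h10 (y : 'rV[R]_n) : `|0 : R| < 1 ^+ 2 by rewrite normr0 expr1n.
have h20 y : `|0 : R| < v y ^+ 2 by rewrite normr0.
have h11 y : psi y != 0 -> psi y != 0 by [].
have h21 y : psi y != 0 -> v y ^+ 2 * psi y != 0.
  by move=> py; rewrite mulf_neq0// gt_eqF.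
have h12 y : psi y = 0 -> psi y = 0 /\ sg y = 0.
  by move=> py; split=> //; rewrite /sg py mul0r.
have h22 y : psi y = 0 -> v y ^+ 2 * psi y = 0 /\ v y ^+ 2 * sg y = 0.
  by move=> py; rewrite /sg py mul0r mulr0.
have {}D1 := D1 h10 h11 h12; have {}D2 := D2 h20 h21 h22.
have I1 : (fun y => \sum_a \sum_b
    tf_einstein_density (fun _ : 'rV[R]_n => two_plane p i j (1 ^+ 2) 0) y a b
    * two_plane p i j (psi y) (sg y) a b) = fun=> 0.
  have one0 (y : 'rV[R]_n) : 0 < 1 :> R by exact: ltr01.
  have p1 (a b : 'I_n) y : partial a (partial b (fun _ : 'rV[R]_n => 1 : R)) y = 0.
    rewrite /partial (_ : 'D_(delta_mx 0 b) _ = fun=> 0) ?derive_cst//.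
    by apply/funext => z; rewrite derive_cst.
  apply/funext => y.
  have E := @tf_einstein_two_plane_conformal R n p i j ij (fun=> 1) psi sg y n0 (scst 1) one0
    (etrans (p1 i j y) (esym (p1 j i y))).
  by rewrite E p1 !mulr0.
have I2 : (fun y => \sum_a \sum_b
    tf_einstein_density (fun z => two_plane p i j (v z ^+ 2) 0) y a b
    * two_plane p i j (v y ^+ 2 * psi y) (v y ^+ 2 * sg y) a b) =
    fun y => 2 * (n%:R - 2) * (psi y * kappa y ^+ 2).
  apply/funext => y.
  have E := @tf_einstein_two_plane_conformal R n p i j ij v (fun y => v y ^+ 2 * psi y)
    (fun y => v y ^+ 2 * sg y) y n0 sv v0 (etrans (pvij y) (esym (pvji y))).
  rewrite E pvij /sg /w; congr (_ * _).
  have vV : v y ^+ 2 * v y ^+ n.-1 * (v y)^-1 ^+ n.+1 = 1.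
    rewrite -exprD (_ : (2 + n.-1)%N = n.+1) -?exprMn ?mulfV ?expr1n//.
      by rewrite gt_eqF.
    by rewrite -[in RHS](prednK n0).
  by rewrite -[RHS]mul1r -vV; ring.
rewrite I1 integral_rV0 in D1; rewrite I2 in D2.
have near12 : \forall t \near (0 : R),
    act (fun y => 1 ^+ 2 + t * psi y) (fun y => 0 + t * sg y) =
    act (fun y => v y ^+ 2 + t * (v y ^+ 2 * psi y)) (fun y => 0 + t * (v y ^+ 2 * sg y)).
  have C0 : 0 < (C1 + C2)^-1 by rewrite invr_gt0 addr_gt0.
  have : \forall t \near (0 : R), `|t| < (C1 + C2)^-1.
    by apply/nbhs_ballP; exists (C1 + C2)^-1 => // t; rewrite /ball/= sub0r normrN.
  (* This [chi] is [v^2 - 1], nonnegative and zero exactly where [psi] is, so the conformal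
     invariance of the action relates the two families at parameter [t]. *)
  apply: filterS => t tC; pose chi y := (2 + psi y) * psi y.
  have schi : smooth_on setT chi := sM _ _ (sD _ _ (scst 2) spsi) spsi.
  have chi0 y : 0 <= chi y by rewrite mulr_ge0 ?addr_ge0.
  have chipsi y : (chi y == 0) = (psi y == 0).
    by rewrite mulf_eq0 gt_eqF// ltr_wpDr.
  have tpsi : smooth_on setT (fun y => 1 + t * psi y) := sD _ _ (scst 1) (sM _ _ (scst t) spsi).
  have C := @two_plane_action_conformal R n M p q i j hpq ij k L varL c0 psi K cK KV psiK
    (fun y => 1 + t * psi y) (fun y => t * sg y) chi n0 tpsi (sM _ _ (scst t) ssg) schi
    (bound t tC) chi0 chipsi.
  rewrite /act; transitivity (two_plane_action p i j L c0 psi (fun y => 1 + t * psi y)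
    (fun y => t * sg y)); first by congr two_plane_action; apply/funext => y; rewrite ?expr1n ?add0r.
  rewrite -C; congr two_plane_action; apply/funext => y; rewrite /chi /v; ring.
(* Here [3 <= n] enters. The two actions agree near [t = 0], so their derivatives there coincide,
   although one is 0 and the other a positive integral. *)
have n2 : 0 < 2 * (n%:R - 2) :> R by rewrite mulr_gt0// subr_gt0 ltr_nat.
have := pos _ n2.
rewrite -(derive_val (is_derive:=D2)) -(near_eq_derive (1 : R) near12).
by rewrite (derive_val (is_derive:=D1)) ltxx.
Qed.
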